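(* Let $N$ be a finite set and $f: 2^{N} \to \mathbb{R} \cup \{-\infty\}$ with $\mathrm{dom}\, f \neq \emptyset$. Then $f$ is M$^\natural$-concave if and only if $f$ satisfies the multiple exchange property: for all $X, Y \subseteq N$ and $I \subseteq X \setminus Y$ there exists $J \subseteq Y \setminus X$ with $f(X)+f(Y) \le f((X\setminus I)\cup J) + f((Y \setminus J)\cup I)$.
   Context: For $f: 2^N \to \mathbb{R}\cup\{-\infty\}$, $\mathrm{dom}\, f = \{X \subseteq N : f(X) > -\infty\}$. Notation: $X - i = X \setminus \{i\}$, $Y + i = Y \cup \{i\}$, $X - i + j = (X\setminus\{i\})\cup\{j\}$, $Y + i - j = (Y \cup\{i\})\setminus\{j\}$. Conventions: $(-\infty)+a = a+(-\infty) = (-\infty)+(-\infty) = -\infty$ for $a \in \mathbb{R}$, $-\infty \le -\infty$, and a maximum over an empty set is $-\infty$. A function $f: 2^N \to \mathbb{R}\cup\{-\infty\}$ with $\mathrm{dom}\, f \neq \emptyset$ is M$^\natural$-concave if for all $X, Y \subseteq N$ and $i \in X \setminus Y$: $$f(X)+f(Y) \le \max\Big[ f(X-i)+f(Y+i),\ \max_{j \in Y\setminus X}\{ f(X-i+j)+f(Y+i-j)\}\Big].$$ *)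

(* Defs.v *)
(* Values in R ∪ {-oo} are modelled as [option R],
   with [None] = -oo and [Some x] = x, for an arbitrary real field R
   (in particular the reals). *)
From HB Require Import structures.
From mathcomp Require Import all_boot all_order all_algebra.
Set Implicit Arguments. Unset Strict Implicit. Unset Printing Implicit Defensive.
Import Order.TTheory GRing.Theory Num.Theory.
Local Open Scope ring_scope.

Section Ext.
Variable R : realFieldType.

Definition eadd (a b : option R) : option R :=
  match a, b with Some x, Some y => Some (x + y) | _, _ => None end.

Definition ele (a b : option R) : Prop :=
  match a, b with
  | None, _ => True
  | Some _, None => False
  | Some x, Some y => x <= y
  end.

Definition emax (a b : option R) : option R :=
  match a, b with
  | None, b => b
  | a, None => a
  | Some x, Some y => Some (Num.max x y)
  end.

Definition emax_seq (s : seq (option R)) : option R := foldr emax None s.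

Variable T : finType.

Definition dom (f : {set T} -> option R) : {set {set T}} :=
  [set X | f X != None].

Definition Mnat_concave (f : {set T} -> option R) : Prop :=
  dom f != set0 /\
  forall (X Y : {set T}) (i : T), i \in X :\: Y ->
    ele (eadd (f X) (f Y))
        (emax (eadd (f (X :\ i)) (f (i |: Y)))
              (emax_seq [seq eadd (f (j |: (X :\ i))) (f ((i |: Y) :\ j))
                        | j <- enum (Y :\: X)])).

Definition multiple_exchange (f : {set T} -> option R) : Prop :=
  forall (X Y I : {set T}), I \subset X :\: Y ->
    exists J : {set T}, J \subset Y :\: X /\
      ele (eadd (f X) (f Y)) (eadd (f ((X :\: I) :|: J)) (f ((Y :\: J) :|: I))).

End Ext.

(* Main.v *)
(* From single to multiple exchange: fix X, Y and I, and consider the functions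
   f1(J) = f((X \ I) + J) and f2(J) = f((Y \ J) + I) of J in Y \ X, which are again
   M-natural-concave. Single exchanges show that for every price vector q there are J1, J2 with
   f1(J1) - q(J1) + f2(J2) + q(J2) >= f(X) + f(Y). Take q minimizing the maximum of the left side;
   Fourier-Motzkin elimination shows that the minimum is attained. The maximizers of f1 - q and
   of f2 + q form two generalized matroids. If these had no common member, the intersection
   theorem (proved by deletion and contraction) would give a set A on which prices can be shifted
   to decrease the maximum further. A common member J is what is wanted.

   From multiple to single exchange: multiple exchange implies all single exchanges between sets
   at distance at most two on each side, and a potential argument applied to a violating pair
   at minimal distance propagates them to all pairs. *)
Require Import Defs.
From HB Require Import structures.
From mathcomp Require Import all_boot all_order all_algebra.
From mathcomp Require Import zify ring lra.
Set Implicit Arguments. Unset Strict Implicit. Unset Printing Implicit Defensive.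
Import Order.TTheory GRing.Theory Num.Theory.
Local Open Scope ring_scope.

(** The value -oo is handled by a pair: a family [D] of sets, the domain, and a total real function
    [v]. Inequalities are then linear arithmetic, and memberships in [D] are separate goals. Prices
    are allowed because an exchange preserves the two sets as a multiset union: adding a modular
    [weight q] changes neither the single nor the multiple exchange property. The obstacle to
    composing single exchanges is that the elements of [Y :\: X] gained by one set need not be those
    lost by the other. The price vector is a Lagrange multiplier for this constraint. [R] is an
    arbitrary real field, so no compactness argument yields an optimal price; projecting a finite
    system of inequalities does. The set A comes from counting: every maximizer of one function
    meets A in fewer elements than every maximizer of the other, so the indicator of A, up to sign,
    is a descent direction. In the converse, the potential makes every small exchange at [i] no gain
    for X and a strict loss for Y, so an exchange that exists for a set closer to X cannot be a loss
    for that set. *)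

Lemma subset_implyb (T : finType) (A B : {set T}) (z : T) :
  A \subset B -> (z \in A) ==> (z \in B).
Proof. by move=> /subsetP sAB; apply/implyP/sAB. Qed.

(** Set identities are checked pointwise: inclusions enter as boolean implications through
    [subset_implyb], and all membership bits are then split. *)
Ltac bcase := repeat match goal with
  | |- context [?a \in ?b] => case: (a \in b)
  | |- context [?a == ?b] => case: (a == b)
  end.

(** * M-natural-concave functions, prices and weak exchange *)

Section MNat.
Variables (R : realFieldType) (T : finType).
Implicit Types (D : {set {set T}}) (v : {set T} -> R) (X Y I J A B : {set T}).

(* The set [J] of size at most one stands for both terms of the maximum: [J = set0] for
   (X - i, Y + i) and [J = [set j]] for (X - i + j, Y + i - j). *)
Definition mnat D v := forall X Y i, X \in D -> Y \in D -> i \in X -> i \notin Y ->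
  exists J, [/\ J \subset Y :\: X, (#|J| <= 1)%N, X :\: [set i] :|: J \in D,
    Y :\: J :|: [set i] \in D &
    v X + v Y <= v (X :\: [set i] :|: J) + v (Y :\: J :|: [set i])].

Definition gmatroid D := forall X Y i, X \in D -> Y \in D -> i \in X -> i \notin Y ->
  exists J, [/\ J \subset Y :\: X, (#|J| <= 1)%N, X :\: [set i] :|: J \in D &
    Y :\: J :|: [set i] \in D].

Definition between D A B := [set S in D | (A \subset S) && (S \subset B)].

Definition weight (q : T -> R) X := \sum_(i in X) q i.

(** An exchange keeps both sets between the intersection and the union of X and Y. *)
Lemma mnat_between D v A B : mnat D v -> mnat (between D A B) v.
Proof.
move=> mD X Y i; rewrite !inE => /and3P[XD AX XB] /and3P[YD AY YB] iX iY.
have [J [sJ J1 D1 D2 le]] := mD X Y i XD YD iX iY.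
have iA : i \notin A by apply: contra iY; apply/subsetP.
have iB : i \in B by apply: (subsetP XB).
exists J; split=> //; rewrite inE ?D1 ?D2 /=; apply/andP; split; apply/subsetP => z;
  move: (subset_implyb z sJ) (subset_implyb z AX) (subset_implyb z XB)
    (subset_implyb z AY) (subset_implyb z YB); rewrite !inE;
  case: (eqVneq z i) => [->|_]; rewrite ?(negPf iA) ?iB ?iX ?(negPf iY) //=; bcase; by [].
Qed.

Lemma weightE q X : weight q X = \sum_i (if i \in X then q i else 0).
Proof. by rewrite /weight big_mkcond. Qed.

(** The elements that leave one set enter the other, so every element keeps its multiplicity in the
    pair. *)
Lemma weight_exchange q X Y I J : I \subset X :\: Y -> J \subset Y :\: X ->
  weight q (X :\: I :|: J) + weight q (Y :\: J :|: I) = weight q X + weight q Y.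
Proof.
move=> sI sJ; rewrite !weightE -!big_split /=; apply: eq_bigr => z _.
move: (subset_implyb z sI) (subset_implyb z sJ); rewrite !inE.
by bcase=> //= _ _; rewrite ?addr0 ?add0r // addrC.
Qed.

Lemma mnat_weight D v q : mnat D v -> mnat D (fun S => v S + weight q S).
Proof.
move=> mD X Y i XD YD iX iY.
have [J [sJ J1 D1 D2 le]] := mD X Y i XD YD iX iY.
have sI : [set i] \subset X :\: Y by rewrite sub1set inE iX iY.
exists J; split=> //; have := weight_exchange q sI sJ; lra.
Qed.

Definition argmaxs D v := [set S in D | [forall U in D, v U <= v S]].

Lemma argmaxsP D v S : reflect (S \in D /\ forall U, U \in D -> v U <= v S)
  (S \in argmaxs D v).
Proof.
rewrite inE; apply: (iffP andP) => [[SD /forall_inP h]|[SD h]]; split=> //.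
by apply/forall_inP.
Qed.

(** If two values are maximal, their sum can only be matched by two maximal values. *)
Lemma gmatroid_argmaxs D v : mnat D v -> gmatroid (argmaxs D v).
Proof.
move=> mD X Y i /argmaxsP[XD Xm] /argmaxsP[YD Ym] iX iY.
have [J [sJ J1 D1 D2 le]] := mD X Y i XD YD iX iY.
by exists J; split=> //; apply/argmaxsP; split=> // U UD;
  have := Xm _ UD; have := Ym _ UD; have := Xm _ D1; have := Ym _ D2; lra.
Qed.

Lemma argmaxs_ex D v : D != set0 -> exists S, S \in argmaxs D v.
Proof.
case/set0Pn=> S0 S0D; exists [arg max_(S > S0 in D) v S]%O.
by case: arg_maxP => // S SD Sm; apply/argmaxsP; split.
Qed.

(** The hypothesis is submodularity for nested sets and one element (decreasing marginal values);
    the conclusion moves a whole set. [P] marks the sets where the value is meaningful. Used for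
    best values on traces and for [maxcap]. *)
Lemma nested_exchange (P : pred {set T}) v :
  (forall X Y i, P X -> P Y -> Y \subset X -> i \in X -> i \notin Y ->
    [/\ P (X :\ i), P (i |: Y) & v X + v Y <= v (X :\ i) + v (i |: Y)]) ->
  forall X Y I, P X -> P Y -> Y \subset X -> I \subset X :\: Y ->
    [/\ P (X :\: I), P (Y :|: I) & v X + v Y <= v (X :\: I) + v (Y :|: I)].
Proof.
move=> step X Y I; have [n] := ubnP #|I|; elim: n => // n IHn in X Y I *.
move=> /ltnSE leIn PX PY sYX sI.
have [->|[i iI]] := set_0Vmem I; first by rewrite setD0 setU0.
have /[!inE]/andP[iY iX] := subsetP sI i iI.
have [PXi PYi lei] := step X Y i PX PY sYX iX iY.
have cI : (#|I :\ i| < n)%N by move: leIn; rewrite (cardsD1 i I) iI; lia.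
(* The induction hypothesis for X and [i |: Y], added to the step for [X :\: (I :\ i)] and Y: the
   values at [i |: Y] and at [X :\: (I :\ i)] cancel. *)
have [||PXI PYI leI] := IHn X (i |: Y) (I :\ i) cI PX PYi.
- by rewrite subUset sub1set iX.
- apply/subsetP => z; move: (subset_implyb z sI); rewrite !inE; bcase; by [].
have [|||P1 P2 le2] := step (X :\: (I :\ i)) Y i PXI PY.
- apply/subsetP => z; move: (subset_implyb z sI) (subset_implyb z sYX); rewrite !inE; bcase; by [].
- by rewrite !inE eqxx iX.
- by [].
have e1 : (X :\: (I :\ i)) :\ i = X :\: I.
  by apply/setP => z; rewrite !inE; case: (eqVneq z i) => [->|_]; rewrite ?iI; bcase.
have e2 : i |: Y :|: I :\ i = Y :|: I.
  by apply/setP => z; rewrite !inE; case: (eqVneq z i) => [->|_]; rewrite ?iI; bcase.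
by move: P1 PYI le2 leI; rewrite e1 e2 => P1 PYI le2 leI; split=> //; lra.
Qed.

(* The best value [h P] of a set with trace [P] on [X :\: Y] satisfies the hypothesis of
   [nested_exchange]. Compared with multiple exchange, the traces of [S] and [U] on [Y :\: X]
   need not be complementary. *)
Lemma weak_exchange D v X Y I : mnat D v -> X \in D -> Y \in D -> I \subset X :\: Y ->
  exists S U, [/\ S \in D, U \in D, S :&: (X :\: Y) = X :\: Y :\: I, U :&: (X :\: Y) = I &
   v X + v Y <= v S + v U].
Proof.
move=> mD XD YD sI; set E := X :\: Y.
pose F P := [set S in D | S :&: E == P].
(* The default [set0] is reached only if no set of D has trace P, which the predicate passed to
   [nested_exchange] excludes. *)
pose h P := v (odflt set0 [pick S in argmaxs (F P) v]).
have hP P : F P != set0 -> exists S, [/\ S \in F P, h P = v S & forall U, U \in F P -> v U <= v S].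
  move=> /(argmaxs_ex v)[S Sm]; rewrite /h; case: pickP => [U /argmaxsP[]|/(_ S)].
    by exists U.
  by rewrite Sm.
have h_ge P S : S \in F P -> v S <= h P.
  by move=> SF; have [|U [_ ->]] := hP P; [apply/set0Pn; exists S | apply].
have [|||||PX PY le] := @nested_exchange (fun P => F P != set0) h _ E set0 I.
- move=> A B i /hP[S [SF -> _]] /hP[U [UF -> _]] sBA iA iB.
  move: SF UF; rewrite !inE => /andP[SD /eqP eS] /andP[UD /eqP eU].
  have /setIP[iS iE] : i \in S :&: E by rewrite eS.
  have iU : i \notin U by move: iB; rewrite -eU in_setI iE andbT.
  (* The traces are nested, B inside A, so J, taken from [U :\: S], avoids E: only [i] changes the
     traces. *)
  have [J [sJ J1 D1 D2 leJ]] := mD S U i SD UD iS iU.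
  have F1 : S :\: [set i] :|: J \in F (A :\ i).
    rewrite inE D1; apply/eqP/setP => z; move: (subset_implyb z sJ) (subset_implyb z sBA).
    by rewrite -eS -eU !inE; bcase.
  have F2 : U :\: J :|: [set i] \in F (i |: B).
    rewrite inE D2; apply/eqP/setP => z; move: (subset_implyb z sJ) (subset_implyb z sBA) iE.
    by rewrite -eS -eU !inE; case: (eqVneq z i) => [->|_]; bcase.
  split; try by [apply/set0Pn; eexists; eassumption].
  by apply: (le_trans leJ); rewrite lerD ?h_ge.
- by apply/set0Pn; exists X; rewrite inE XD; apply/eqP/setIidPr/subsetDl.
- apply/set0Pn; exists Y; rewrite inE YD; apply/eqP/setP => z; rewrite !inE; bcase; by [].
- by apply: sub0set.
- by rewrite setD0.
have [S [SF eS _]] := hP _ PX; have [U [UF eU _]] := hP _ PY.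
have XF : X \in F E by rewrite inE XD; apply/eqP/setIidPr/subsetDl.
have YF : Y \in F set0.
  rewrite inE YD; apply/eqP/setP => z; rewrite !inE; bcase; by [].
move: SF UF; rewrite !inE set0U => /andP[SD /eqP SE] /andP[UD /eqP UE].
exists S, U; split=> //; rewrite -eS -eU.
by apply: le_trans le; rewrite lerD ?h_ge.
Qed.
End MNat.

(** * Generalized matroid intersection *)

Ltac card_lia := repeat match goal with |- context [#|?A|] => generalize (#|A|) end;
  clear; intros; lia.

Section GMatroid.
Local Open Scope nat_scope.
Variables (T : finType).
Implicit Types (D : {set {set T}}) (X Y I J S A B : {set T}).

Definition co_family D := [set S | ~: S \in D].

Definition maxcap D A := \max_(S in D) #|S :&: A|.
(** The least [#|S :&: A|] over S in D. Complements turn the minimum into a maximum, so statements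
    on [maxcap] dualize. *)
Definition mincap D A := #|A| - maxcap (co_family D) A.

Lemma maxcap_ge D S A : S \in D -> #|S :&: A| <= maxcap D A.
Proof. by move=> SD; rewrite /maxcap (bigD1 S) //= leq_maxl. Qed.

Lemma maxcap_ex D A : D != set0 -> exists2 S, S \in D & maxcap D A = #|S :&: A|.
Proof.
rewrite -card_gt0 => /(eq_bigmax_cond (fun S => #|S :&: A|)) [S SD e].
by exists S.
Qed.

Lemma cardsCI S A : #|S :&: A| + #|~: S :&: A| = #|A|.
Proof. by rewrite -(cardsID S A) setIC [~: S :&: A]setIC -setDE. Qed.

Lemma co_familyC S D : (~: S \in co_family D) = (S \in D).
Proof. by rewrite inE setCK. Qed.

Lemma co_family_neq0 D : D != set0 -> co_family D != set0.
Proof. by case/set0Pn=> S SD; apply/set0Pn; exists (~: S); rewrite co_familyC. Qed.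

Lemma mincap_le D S A : S \in D -> mincap D A <= #|S :&: A|.
Proof.
rewrite -co_familyC => /(maxcap_ge A); rewrite /mincap -(cardsCI S A); lia.
Qed.

Lemma mincap_ex D A : D != set0 -> exists2 S, S \in D & mincap D A = #|S :&: A|.
Proof.
move=> /co_family_neq0/(maxcap_ex A)[S SD e]; exists (~: S); first by move: SD; rewrite inE.
rewrite /mincap e -(cardsCI S A); lia.
Qed.

Lemma gmatroid_co D : gmatroid D -> gmatroid (co_family D).
Proof.
move=> gD X Y i /[!inE] XD YD iX iY.
have [||J [sJ J1 D1 D2]] := gD (~: Y) (~: X) i YD XD; rewrite ?inE ?iX ?iY //.
exists J; split=> //.
- by apply/subsetP => z; move: (subset_implyb z sJ); rewrite !inE; bcase.
- rewrite inE; suff -> : ~: (X :\: [set i] :|: J) = ~: X :\: J :|: [set i] by [].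
  apply/setP => z; move: (subset_implyb z sJ); rewrite !inE.
  by case: (eqVneq z i) => [->|_]; rewrite ?iX ?(negPf iY); bcase.
- rewrite inE; suff -> : ~: (Y :\: J :|: [set i]) = ~: Y :\: [set i] :|: J by [].
  apply/setP => z; move: (subset_implyb z sJ); rewrite !inE.
  by case: (eqVneq z i) => [->|_]; rewrite ?iX ?(negPf iY); bcase.
Qed.

Lemma cap_setU1D1 X J A i : i \in X -> [disjoint X & J] ->
  #|(X :\: [set i] :|: J) :&: A| + (i \in A) = #|X :&: A| + #|J :&: A|.
Proof.
move=> iX dXJ; rewrite setIUl cardsU.
have -> : (X :\: [set i]) :&: A :&: (J :&: A) = set0.
  apply/setP => z; rewrite !inE; have := disjointFr dXJ (x := z).
  by case: (z \in X) => [->|]; rewrite ?andbF.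
rewrite cards0 (cardsD1 i (X :&: A)) inE iX /= setIDAC; lia.
Qed.

Lemma cap_setD_U1 Y J A i : i \notin Y -> J \subset Y ->
  #|(Y :\: J :|: [set i]) :&: A| + #|J :&: A| = #|Y :&: A| + (i \in A).
Proof.
move=> iY sJ; have iJ : i \notin J by apply: contra iY; apply/subsetP.
have -> : (Y :\: J :|: [set i]) :&: A = (Y :&: A :\: J :&: A) :|: [set i] :&: A.
  by apply/setP => z; rewrite !inE; bcase.
rewrite cardsU cardsD.
have -> : (Y :&: A :\: J :&: A) :&: ([set i] :&: A) = set0.
  by apply/setP => z; rewrite !inE; case: (eqVneq z i) => [->|_]; rewrite ?(negPf iY); bcase.
have -> : Y :&: A :&: (J :&: A) = J :&: A.
  by apply/setP => z; move: (subset_implyb z sJ); rewrite !inE; bcase.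
have -> : #|[set i] :&: A| = (i \in A).
  case: (boolP (i \in A)) => iA; last first.
    by rewrite disjoint_setI0 ?cards0 // disjoints1.
  by rewrite (setIidPl _) ?cards1 // sub1set.
have : #|J :&: A| <= #|Y :&: A| by apply/subset_leq_card/setSI.
rewrite cards0; lia.
Qed.

(** All that the counting arguments need of an exchange: its effect on the size of the intersection
    with any A, in additive form to avoid truncated subtraction. *)
Lemma gmatroid_exchange D X Y i : gmatroid D -> X \in D -> Y \in D ->
  i \in X -> i \notin Y ->
  exists X' Y' J, [/\ (X' \in D) && (Y' \in D), #|J| <= 1, (i \notin X') && (i \in Y'),
    forall A, #|X' :&: A| + (i \in A) = #|X :&: A| + #|J :&: A| &
    forall A, #|Y' :&: A| + #|J :&: A| = #|Y :&: A| + (i \in A)].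
Proof.
move=> gD XD YD iX iY; have [J [sJ J1 D1 D2]] := gD X Y i XD YD iX iY.
move: sJ; rewrite subsetD => /andP[sJ dJ].
exists (X :\: [set i] :|: J), (Y :\: J :|: [set i]), J; split=> //.
- by rewrite D1.
- have /negPf iJ : i \notin J by apply: contra iY; apply/subsetP.
  by rewrite !inE eqxx iJ orbT.
- by move=> A; apply: cap_setU1D1; rewrite // disjoint_sym.
- by move=> A; apply: cap_setD_U1.
Qed.

Lemma cap1U S A e : e \notin A -> #|S :&: (e |: A)| = (e \in S) + #|S :&: A|.
Proof.
move=> eA; rewrite (cardsD1 e) !inE eqxx andbT; congr (_ + #|pred_of_set _|).
by apply/setP => z; rewrite !inE; case: (eqVneq z e) => [->|_]; rewrite ?(negPf eA) ?andbF.
Qed.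

(** Exchange [i] between a maximizer S for [i |: A] and a maximizer U for B. The set J then costs U
    [#|J :&: B|] and brings S at least as much in A, because B lies in A. *)
Lemma maxcap_step D A B i : gmatroid D -> D != set0 -> B \subset A -> i \notin A ->
  maxcap D (i |: A) + maxcap D B <= maxcap D A + maxcap D (i |: B).
Proof.
move=> gD D0 sBA iA; have iB : i \notin B by apply: contra iA; apply/subsetP.
have [S SD ->] := maxcap_ex (i |: A) D0; have [U UD ->] := maxcap_ex B D0.
rewrite cap1U //.
have := maxcap_ge A SD; have := maxcap_ge (i |: B) UD; rewrite cap1U //.
case: (boolP (i \in S)) => iS; last by card_lia.
case: (boolP (i \in U)) => iU; first by card_lia.
have [S' [U' [J [/andP[S'D U'D] J1 /andP[/negPf iS' iU'] eS eU]]]] :=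
  gmatroid_exchange gD SD UD iS iU.
move: (maxcap_ge A S'D) (maxcap_ge (i |: B) U'D) (eS A) (eU B).
rewrite cap1U // iU' (negPf iA) (negPf iB).
have : #|J :&: B| <= #|J :&: A| by apply/subset_leq_card/setIS.
card_lia.
Qed.

Lemma maxcap_submod D A B : gmatroid D -> D != set0 ->
  maxcap D (A :|: B) + maxcap D (A :&: B) <= maxcap D A + maxcap D B.
Proof.
move=> gD D0.
(* Counts are cast to [rat] because [nested_exchange] takes values in a real field. Moving [B :\: A]
   from the union to the intersection leaves A and B. *)
have [|||_ _] := @nested_exchange rat T predT (fun A => (maxcap D A)%:R) _
  (A :|: B) (A :&: B) (B :\: A) isT isT.
- move=> X Y i _ _ sYX iX iY; split=> //.
  rewrite -!natrD ler_nat -{1}(setD1K iX) maxcap_step //.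
    by apply/subsetD1P.
  by rewrite !inE eqxx.
- by apply/subsetP => z; rewrite !inE => /andP[->].
- by apply/subsetP => z; rewrite !inE; bcase.
rewrite -!natrD ler_nat.
have -> : (A :|: B) :\: (B :\: A) = A by apply/setP => z; rewrite !inE; bcase.
have -> // : A :&: B :|: B :\: A = B by apply/setP => z; rewrite !inE; bcase.
Qed.

Lemma mincapE D A : D != set0 -> mincap D A + maxcap (co_family D) A = #|A|.
Proof.
move=> D0; rewrite /mincap subnK //.
have [S _ ->] := maxcap_ex A (co_family_neq0 D0).
by rewrite subset_leq_card ?subsetIr.
Qed.

Lemma mincap_supermod D A B : gmatroid D -> D != set0 ->
  mincap D A + mincap D B <= mincap D (A :|: B) + mincap D (A :&: B).
Proof.
move=> gD D0; have := maxcap_submod A B (gmatroid_co gD) (co_family_neq0 D0).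
have := mincapE A D0; have := mincapE B D0.
have := mincapE (A :&: B) D0; have := mincapE (A :|: B) D0.
have := cardsUI A B; lia.
Qed.

(** In the critical case [i] is in the minimizer for B and not in the maximizer for A. Exchanging it
    gains one in [i |: A], and J costs at most one in total because A and B are disjoint. *)
Lemma maxcap_mincap_step D A B i : gmatroid D -> D != set0 ->
  [disjoint A & B] -> i \notin A -> i \notin B ->
  maxcap D A + mincap D (i |: B) <= maxcap D (i |: A) + mincap D B.
Proof.
move=> gD D0 dAB iA iB.
have [S SD ->] := maxcap_ex A D0; have [U UD ->] := mincap_ex B D0.
have := maxcap_ge (i |: A) SD; have := mincap_le (i |: B) UD; rewrite !cap1U //.
case: (boolP (i \in S)) => iS; first by card_lia.
case: (boolP (i \in U)) => iU; last by card_lia.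
have [U' [S' [J [/andP[U'D S'D] J1 /andP[/negPf iU' iS'] eU eS]]]] :=
  gmatroid_exchange gD UD SD iU iS.
move: (maxcap_ge (i |: A) S'D) (mincap_le (i |: B) U'D) (eU B) (eS A).
rewrite !cap1U // iU' iS' (negPf iA) (negPf iB).
have : #|J :&: A| + #|J :&: B| <= #|J|.
  rewrite -cardsUI [X in _ + #|pred_of_set X|](_ : _ = set0) ?cards0 ?addn0.
    by apply: subset_leq_card; rewrite subUset !subsetIl.
  apply/setP => z; rewrite !inE; have := disjointFr dAB (x := z).
  by case: (z \in A) => [->|]; rewrite ?andbF.
move: J1; card_lia.
Qed.

(** The cross inequality between the upper and lower bounds of a generalized polymatroid. Common
    elements of A and B are treated one at a time by [maxcap_mincap_step]. *)
Lemma maxcap_mincap_cross D A B : gmatroid D -> D != set0 ->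
  maxcap D (A :\: B) + mincap D B <= maxcap D A + mincap D (B :\: A).
Proof.
move=> gD D0; have [n] := ubnP #|A :&: B|; elim: n => // n IHn in A B *.
have [e|[i /setIP[iA iB]]] := set_0Vmem (A :&: B).
  rewrite (setDidPl _) -?setI_eq0 ?e // (setDidPl _) // -setI_eq0 setIC e //.
rewrite (cardsD1 i) inE iA iB => /ltnSE ltn.
have := IHn (A :\ i) B; have -> : (A :\ i) :&: B = A :&: B :\ i.
  by apply/setP => z; rewrite !inE; bcase.
move=> /(_ ltn).
have -> : B :\: (A :\ i) = i |: B :\: A.
  by apply/setP => z; rewrite !inE; case: (eqVneq z i) => [->|_]; rewrite ?iB; bcase.
have -> : A :\ i :\: B = A :\: B.
  by apply/setP => z; rewrite !inE; case: (eqVneq z i) => [->|_]; rewrite ?iB; bcase.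
have := @maxcap_mincap_step D (A :\ i) (B :\: A) i gD D0.
rewrite setD1K //.
have -> : [disjoint A :\ i & B :\: A].
  by rewrite -setI_eq0; apply/eqP/setP => z; rewrite !inE; bcase.
rewrite !inE eqxx iA; move=> /(_ isT isT isT); lia.
Qed.

(** Both minors are subfamilies of D on the same ground type; in particular [contraction] leaves e
    in its members. *)
Definition deletion D e := [set S in D | e \notin S].
Definition contraction D e := [set S in D | e \in S].

Lemma gmatroid_deletion D e : gmatroid D -> gmatroid (deletion D e).
Proof.
move=> gD X Y i /setIdP[XD eX] /setIdP[YD eY] iX iY.
have [J [sJ J1 D1 D2]] := gD X Y i XD YD iX iY.
exists J; split=> //; rewrite inE ?D1 ?D2 /=; move: (subset_implyb e sJ) iX;
  rewrite !inE (negPf eX) (negPf eY) ?andbF /= implybF //.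
by case: (eqVneq e i) => // <-; rewrite (negPf eX).
Qed.

Lemma gmatroid_contraction D e : gmatroid D -> gmatroid (contraction D e).
Proof.
move=> gD X Y i /setIdP[XD eX] /setIdP[YD eY] iX iY.
have [J [sJ J1 D1 D2]] := gD X Y i XD YD iX iY.
exists J; split=> //; rewrite inE ?D1 ?D2 /=; move: (subset_implyb e sJ) iY;
  rewrite !inE eX eY /= implybF.
  by case: (eqVneq e i) => // <-; rewrite eY.
by move=> /negPf->.
Qed.

Section Minors.
Variables (D : {set {set T}}) (e : T) (A : {set T}).
Hypotheses (gD : gmatroid D) (eA : e \notin A).

(** This and the next three lemmas exchange e between an optimal set of D and some member of the
    minor. At most one other element moves the opposite way, which accounts for the extra e or the
    successor in the bounds. *)
Lemma maxcap_deletion : deletion D e != set0 -> maxcap D A <= maxcap (deletion D e) A.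
Proof.
move=> D0; have /set0Pn[U /setIdP[UD eU]] := D0.
have [|S SD ->] := @maxcap_ex D A; first by apply/set0Pn; exists U.
case: (boolP (e \in S)) => eS; last by apply: maxcap_ge; rewrite inE SD.
have [S' [U' [J [/andP[S'D U'D] J1 /andP[iS' iU'] cS cU]]]] := gmatroid_exchange gD SD UD eS eU.
have : S' \in deletion D e by rewrite inE S'D.
move/(maxcap_ge A); move: (cS A); rewrite (negPf eA); card_lia.
Qed.

Lemma mincap_deletion : deletion D e != set0 -> mincap (deletion D e) A <= mincap D (e |: A).
Proof.
move=> D0; have /set0Pn[U /setIdP[UD eU]] := D0.
have [|S SD ->] := @mincap_ex D (e |: A); first by apply/set0Pn; exists U.
rewrite cap1U //; case: (boolP (e \in S)) => eS; last by apply: mincap_le; rewrite inE SD.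
have [S' [U' [J [/andP[S'D U'D] J1 /andP[iS' iU'] cS cU]]]] := gmatroid_exchange gD SD UD eS eU.
have : S' \in deletion D e by rewrite inE S'D.
move/(mincap_le A); move: (cS A); rewrite (negPf eA).
have : #|J :&: A| <= #|J| by rewrite subset_leq_card ?subsetIl.
move: J1; card_lia.
Qed.

Lemma maxcap_contraction : contraction D e != set0 ->
  maxcap D (e |: A) <= (maxcap (contraction D e) A).+1.
Proof.
move=> D0; have /set0Pn[U /setIdP[UD eU]] := D0.
have [|S SD ->] := @maxcap_ex D (e |: A); first by apply/set0Pn; exists U.
rewrite cap1U //; case: (boolP (e \in S)) => eS; first by apply: maxcap_ge; rewrite inE SD.
have [U' [S' [J [/andP[U'D S'D] J1 /andP[iU' iS'] cU cS]]]] := gmatroid_exchange gD UD SD eU eS.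
have : S' \in contraction D e by rewrite inE S'D.
move/(maxcap_ge A); move: (cS A); rewrite (negPf eA).
have : #|J :&: A| <= #|J| by rewrite subset_leq_card ?subsetIl.
move: J1; card_lia.
Qed.

Lemma mincap_contraction : contraction D e != set0 ->
  mincap (contraction D e) A <= mincap D A.
Proof.
move=> D0; have /set0Pn[U /setIdP[UD eU]] := D0.
have [|S SD ->] := @mincap_ex D A; first by apply/set0Pn; exists U.
case: (boolP (e \in S)) => eS; first by apply: mincap_le; rewrite inE SD.
have [U' [S' [J [/andP[U'D S'D] J1 /andP[iU' iS'] cU cS]]]] := gmatroid_exchange gD UD SD eU eS.
have : S' \in contraction D e by rewrite inE S'D.
move/(mincap_le A); move: (cS A); rewrite (negPf eA); card_lia.
Qed.

End Minors.

(** Add submodularity of [maxcap D1] at A and [e |: B] to supermodularity of [mincap D2] at [e |: A]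
    and B: both pairs have the same union and the same intersection. *)
Lemma uncross_same D1 D2 A B e : gmatroid D1 -> gmatroid D2 -> D1 != set0 -> D2 != set0 ->
  e \notin A -> e \notin B ->
  maxcap D1 A < mincap D2 (e |: A) -> maxcap D1 (e |: B) <= mincap D2 B ->
  (maxcap D1 (A :|: (e |: B)) < mincap D2 (A :|: (e |: B))) ||
  (maxcap D1 (A :&: B) < mincap D2 (A :&: B)).
Proof.
move=> g1 g2 n1 n2 eA eB.
have := maxcap_submod A (e |: B) g1 n1; have := mincap_supermod (e |: A) B g2 n2.
have -> : e |: A :|: B = A :|: (e |: B) by rewrite setUCA setUA.
have -> : (e |: A) :&: B = A :&: B.
  by apply/setP => z; rewrite !inE; case: (eqVneq z e) => [->|//]; rewrite (negPf eB) !andbF.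
have -> : A :&: (e |: B) = A :&: B.
  by apply/setP => z; rewrite !inE; case: (eqVneq z e) => [->|//]; rewrite (negPf eA).
clear; lia.
Qed.

(** The separations point in opposite directions, so two cross inequalities are added: at A and B
    for D1, at [e |: B] and [e |: A] for D2. In the latter e drops out of the differences. *)
Lemma uncross_mixed D1 D2 A B e : gmatroid D1 -> gmatroid D2 -> D1 != set0 -> D2 != set0 ->
  e \notin A -> e \notin B ->
  maxcap D1 A < mincap D2 (e |: A) -> maxcap D2 (e |: B) <= mincap D1 B ->
  (maxcap D1 (A :\: B) < mincap D2 (A :\: B)) ||
  (maxcap D2 (B :\: A) < mincap D1 (B :\: A)).
Proof.
move=> g1 g2 n1 n2 eA eB.
have := maxcap_mincap_cross A B g1 n1; have := maxcap_mincap_cross (e |: B) (e |: A) g2 n2.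
have cut (C C' : {set T}) : e \notin C -> (e |: C) :\: (e |: C') = C :\: C'.
  move=> eC; apply/setP => z; rewrite !inE; case: (eqVneq z e) => [->|//].
  by rewrite (negPf eC) andbF.
rewrite !cut //; clear; lia.
Qed.

(** Induction on U, outside which all members agree with Z. Deleting e gives a separation with e
    added on the [mincap] side only; contracting e gives one that may be an equality, with e on the
    [maxcap] side. Uncrossing the two recovers a strict separation for one of the resulting sets. *)
Lemma gmatroid_disjoint_separated D1 D2 U Z : gmatroid D1 -> gmatroid D2 ->
  D1 != set0 -> D2 != set0 -> [disjoint D1 & D2] ->
  (forall S, S \in D1 :|: D2 -> S :\: U = Z) ->
  exists2 A : {set T}, A \subset U & (maxcap D1 A < mincap D2 A) || (maxcap D2 A < mincap D1 A).
Proof.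
have [n] := ubnP #|U|; elim: n => // n IHn in D1 D2 U Z *.
move=> /ltnSE ltn g1 g2 D10 D20 dis eqZ.
have [U0|[e eU]] := set_0Vmem U.
  (* With U empty, Z is a member of both families, against disjointness. *)
  have /set0Pn[S S1] := D10; have /set0Pn[S' S2] := D20.
  have e1 : S = Z by rewrite -(eqZ S) ?inE ?S1 // U0 setD0.
  have e2 : S' = Z by rewrite -(eqZ S') ?inE ?S2 ?orbT // U0 setD0.
  by move: (disjointFr dis S1); rewrite e1 -e2 S2.
have cU : #|U :\ e| < n by move: ltn; rewrite (cardsD1 e U) eU.
have eN (A : {set T}) : A \subset U :\ e -> e \notin A by case/subsetD1P.
have sU (A : {set T}) : A \subset U :\ e -> A \subset U by case/subsetD1P.
have sUe (A : {set T}) : A \subset U :\ e -> e |: A \subset U by move=> /sU;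
  rewrite subUset sub1set eU.
have disS P : [disjoint [set S in D1 | P S] & [set S in D2 | P S]].
  rewrite -setI_eq0; apply/eqP/setP => S; rewrite !inE; have := disjointFr dis (x := S).
  by case: (S \in D1) => // ->; rewrite ?andbF.
have del : deletion D1 e != set0 -> deletion D2 e != set0 -> exists2 A : {set T}, A \subset U :\ e &
    (maxcap D1 A < mincap D2 (e |: A)) || (maxcap D2 A < mincap D1 (e |: A)).
  move=> n1 n2; have [|A sA p] := IHn _ _ (U :\ e) Z cU (gmatroid_deletion (e := e) g1)
    (gmatroid_deletion (e := e) g2) n1 n2 (disS (fun S => e \notin S)).
    move=> S; rewrite !inE -andb_orl -in_setU => /andP[SD eS]; rewrite -(eqZ S) // setDDr.
    by rewrite (disjoint_setI0 (A := S)) ?setU0 // disjoint_sym disjoints1.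
  exists A => //; have eA := eN A sA.
  have := maxcap_deletion g1 eA n1; have := maxcap_deletion g2 eA n2.
  have := mincap_deletion g1 eA n1; have := mincap_deletion g2 eA n2; move: p; clear; lia.
have con : contraction D1 e != set0 -> contraction D2 e != set0 ->
  exists2 A : {set T}, A \subset U :\ e &
    (maxcap D1 (e |: A) <= mincap D2 A) || (maxcap D2 (e |: A) <= mincap D1 A).
  move=> n1 n2; have [|A sA p] := IHn _ _ (U :\ e) (e |: Z) cU (gmatroid_contraction (e := e) g1)
    (gmatroid_contraction (e := e) g2) n1 n2 (disS (fun S => e \in S)).
    move=> S; rewrite !inE -andb_orl -in_setU => /andP[SD eS]; rewrite -(eqZ S) // setDDr setUC.
    by rewrite (setIidPr _) ?sub1set.
  exists A => //; have eA := eN A sA.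
  have := maxcap_contraction g1 eA n1; have := maxcap_contraction g2 eA n2.
  have := mincap_contraction g1 eA n1; have := mincap_contraction g2 eA n2; move: p; clear; lia.
(* If one minor is empty, e lies in all members or in none, and the effect of adding e to A is known
   exactly. This replaces the missing separation of the minors. *)
have noDel D A : D != set0 -> deletion D e = set0 -> e \notin A ->
    maxcap D A < maxcap D (e |: A) /\ mincap D A < mincap D (e |: A).
  move=> D0 d0 eA; have eD S : S \in D -> e \in S.
    by move=> SD; apply/negPn/negP => eS; have := in_set0 S; rewrite -d0 inE SD eS.
  have [S SD ->] := maxcap_ex A D0; have := maxcap_ge (e |: A) SD.
  have [S' S'D ->] := mincap_ex (e |: A) D0; have := mincap_le A S'D.
  by rewrite !cap1U // !eD //; split.
have noCon D A : D != set0 -> contraction D e = set0 -> e \notin A ->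
    maxcap D (e |: A) <= maxcap D A /\ mincap D (e |: A) <= mincap D A.
  move=> D0 d0 eA; have eD S : S \in D -> e \in S = false.
    by move=> SD; apply/negP => eS; have := in_set0 S; rewrite -d0 inE SD eS.
  have [S SD ->] := maxcap_ex (e |: A) D0; have := maxcap_ge A SD.
  have [S' S'D ->] := mincap_ex A D0; have := mincap_le (e |: A) S'D.
  by rewrite !cap1U // !eD //; split.
have e0 : e \notin set0 by rewrite inE.
have [/andP[d1 d2]|dd] := boolP ((deletion D1 e != set0) && (deletion D2 e != set0));
  have [/andP[c1 c2]|cc] := boolP ((contraction D1 e != set0) && (contraction D2 e != set0)).
- have [A sA hA] := del d1 d2; have [B sB hB] := con c1 c2.
  have eA := eN A sA; have eB := eN B sB.
  have sAB : A :|: (e |: B) \subset U by rewrite subUset sU ?sUe.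
  have sI : A :&: B \subset U by rewrite (subset_trans _ (sU A sA)) ?subsetIl.
  have sD : A :\: B \subset U by rewrite (subset_trans _ (sU A sA)) ?subsetDl.
  have sD' : B :\: A \subset U by rewrite (subset_trans _ (sU B sB)) ?subsetDl.
  case/orP: hA => hA; case/orP: hB => hB.
  + have /orP[h|h] := uncross_same g1 g2 D10 D20 eA eB hA hB.
      by exists (A :|: (e |: B)); rewrite ?h.
    by exists (A :&: B); rewrite ?h.
  + have /orP[h|h] := uncross_mixed g1 g2 D10 D20 eA eB hA hB.
      by exists (A :\: B); rewrite ?h.
    by exists (B :\: A); rewrite ?h ?orbT.
  + have /orP[h|h] := uncross_mixed g2 g1 D20 D10 eA eB hA hB.
      by exists (A :\: B); rewrite ?h ?orbT.
    by exists (B :\: A); rewrite ?h.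
  + have /orP[h|h] := uncross_same g2 g1 D20 D10 eA eB hA hB.
      by exists (A :|: (e |: B)); rewrite ?h ?orbT.
    by exists (A :&: B); rewrite ?h ?orbT.
- have [A sA] := del d1 d2; have eA := eN A sA.
  move: cc; rewrite negb_and !negbK => /orP[/eqP c|/eqP c].
    have [h1 h2] := noCon D1 A D10 c eA; case/orP => h.
      by exists (e |: A); rewrite ?sUe ?(leq_ltn_trans h1 h).
    by exists A; rewrite ?sU ?(leq_trans h h2) ?orbT.
  have [h1 h2] := noCon D2 A D20 c eA; case/orP => h.
    by exists A; rewrite ?sU ?(leq_trans h h2).
  by exists (e |: A); rewrite ?sUe ?(leq_ltn_trans h1 h) ?orbT.
- have [A sA] := con c1 c2; have eA := eN A sA.
  move: dd; rewrite negb_and !negbK => /orP[/eqP c|/eqP c].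
    have [h1 h2] := noDel D1 A D10 c eA; case/orP => h.
      by exists A; rewrite ?sU ?(leq_trans h1 h).
    by exists (e |: A); rewrite ?sUe ?(leq_ltn_trans h h2) ?orbT.
  have [h1 h2] := noDel D2 A D20 c eA; case/orP => h.
    by exists (e |: A); rewrite ?sUe ?(leq_ltn_trans h h2).
  by exists A; rewrite ?sU ?(leq_trans h1 h) ?orbT.
(* Here e lies in every member of one family and in no member of the other. *)
exists [set e]; first by rewrite sub1set.
have /set0Pn[S1 S1D] := D10; have /set0Pn[S2 S2D] := D20.
have split D S : S \in D -> deletion D e = set0 -> contraction D e = set0 -> False.
  move=> SD dD cD; case: (boolP (e \in S)) => eS; have := in_set0 S.
    by rewrite -cD inE SD eS.
  by rewrite -dD inE SD eS.
have lt D D' : D != set0 -> D' != set0 -> deletion D e = set0 -> contraction D' e = set0 ->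
    maxcap D' [set e] < mincap D [set e].
  move=> D0 D'0 dD cD; have := noDel D set0 D0 dD e0; have := noCon D' set0 D'0 cD e0.
  rewrite setU0; have [S _ ->] := maxcap_ex set0 D'0; have [S' _ ->] := mincap_ex set0 D0.
  rewrite !setI0 cards0; clear; lia.
move: dd cc; rewrite !negb_and !negbK => /orP[/eqP d|/eqP d] /orP[/eqP c|/eqP c].
- by case: (split _ _ S1D d c).
- by apply/orP; right; apply: lt.
- by apply/orP; left; apply: lt.
- by case: (split _ _ S2D d c).
Qed.
End GMatroid.

(** * Minimizing a maximum of affine functions *)

Section FourierMotzkin.
Variables (R : realFieldType).

Lemma ex_lower_bound (s : seq R) : exists x, all (>= x) s.
Proof.
elim: s => [|y s [x xs]]; first by exists 0.
exists (Num.min x y); rewrite /= ge_min lexx orbT.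
by apply: sub_all xs => z; rewrite ge_min => ->.
Qed.

Lemma ex_maximum (s : seq R) : s != [::] -> exists2 x, x \in s & all (<= x) s.
Proof.
case: s => // y s _; elim: s y => [|z s IH] y; first by exists y; rewrite ?inE /= ?lexx.
have [x xs /= /andP[zx sx]] := IH z; have [yx|xy] := leP y x.
  by exists x; rewrite /= ?yx ?zx // inE xs orbT.
exists y; rewrite ?inE ?eqxx //= lexx (le_trans zx (ltW xy)).
by apply: sub_all sx => w wx; apply: le_trans (ltW xy).
Qed.

Lemma ex_between (ls us : seq R) : allrel <=%R ls us -> exists x, all (<= x) ls && all (>= x) us.
Proof.
elim: ls => [|l ls IH]; first by have [x xs] := ex_lower_bound us; exists x.
rewrite allrel_consl => /andP[lu /IH[x /andP[xl xu]]].
exists (Num.max l x); rewrite /= le_max lexx /=; apply/andP; split.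
  by apply: sub_all xl => z /= zx; rewrite le_max zx orbT.
apply/allP => u uin; rewrite /= ge_max; apply/andP; split; [exact: (allP lu)|exact: (allP xu)].
Qed.

Lemma one_variable_system (C : eqType) (s : seq C) (a r : C -> R) :
  (exists x, {in s, forall c, a c * x + r c <= 0}) <->
  {in s, forall c, a c = 0 -> r c <= 0} /\
  {in s &, forall p n, 0 < a p -> a n < 0 -> a p * r n - a n * r p <= 0}.
Proof.
split=> [[x h]|[h0 h1]].
  split=> [c cs ac|p n ps ns ap an]; first by have := h c cs; rewrite ac mul0r add0r.
  by have := h p ps; have := h n ns; nra.
have [|x /andP[/allP xl /allP xu]] := @ex_between
    [seq - r n / a n | n <- s & a n < 0] [seq - r p / a p | p <- s & 0 < a p].
  apply/allrelP => l u /mapP[n /[!mem_filter]/andP[an ns] ->].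
  move=> /mapP[p /[!mem_filter]/andP[ap ps] ->].
  rewrite ler_pdivlMr // mulrAC ler_ndivrMr //; have := h1 p n ps ns ap an; lra.
exists x => c cs; have [an|ap|a0] := ltgtP (a c) 0.
- have /xl : - r c / a c \in [seq - r n / a n | n <- s & a n < 0].
    by apply/mapP; exists c; rewrite // mem_filter an.
  by rewrite /= ler_ndivrMr //; lra.
- have /xu : - r c / a c \in [seq - r n / a n | n <- s & 0 < a n].
    by apply/mapP; exists c; rewrite // mem_filter ap.
  by rewrite /= ler_pdivlMr //; lra.
by rewrite a0 mul0r add0r h0.
Qed.

Variable (T : finType).

(* [(a, (b, s))] stands for the inequality [\sum_i a i * q i + b <= s * t]. *)
Definition constr : Type := {ffun T -> R} * (R * R).
Definition slack (c : constr) (q : T -> R) t := \sum_i c.1 i * q i + c.2.1 - c.2.2 * t.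
Definition feasible (s : seq constr) q t := {in s, forall c, slack c q t <= 0}.
Definition upd (q : T -> R) i x j := if j == i then x else q j.

Lemma eq_slack c q q' t : q =1 q' -> slack c q t = slack c q' t.
Proof. by move=> e; rewrite /slack; under eq_bigr do rewrite e. Qed.

Lemma slack_upd c q i x t : slack c (upd q i x) t = slack c q t + c.1 i * (x - q i).
Proof.
rewrite /slack (bigD1 i) //= [in RHS](bigD1 i) //= /upd eqxx.
rewrite (eq_bigr (fun j => c.1 j * q j)) => [|j /negPf->//]; ring.
Qed.

(** For [p.1 i > 0 > n.1 i] the multipliers are positive, and the coefficient of [q i] vanishes. *)
Definition combine i (p n : constr) : constr :=
  ([ffun j => p.1 i * n.1 j - n.1 i * p.1 j],
   (p.1 i * n.2.1 - n.1 i * p.2.1, p.1 i * n.2.2 - n.1 i * p.2.2)).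

Lemma slack_combine i p n q t :
  slack (combine i p n) q t = p.1 i * slack n q t - n.1 i * slack p q t.
Proof.
rewrite /slack /=.
under eq_bigr do rewrite ffunE mulrBl -!mulrA.
rewrite sumrB -!mulr_sumr; ring.
Qed.

Lemma eliminate i s : exists s', forall q t,
  feasible s' q t <-> exists x, feasible s (upd q i x) t.
Proof.
exists ([seq c : constr <- s | c.1 i == 0] ++
  [seq combine i p n | p <- [seq c : constr <- s | 0 < c.1 i],
    n <- [seq c : constr <- s | c.1 i < 0]]) => q t.
have -> : (exists x, feasible s (upd q i x) t) <->
    exists x, {in s, forall c : constr, c.1 i * x + (slack c q t - c.1 i * q i) <= 0}.
  by split=> -[x h]; exists x => c /h; rewrite slack_upd; lra.
rewrite one_variable_system; split=> [h|[h0 h1] c].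
  split=> [c cs c0|p n ps ns ap an].
    by rewrite c0 mul0r subr0; apply: h; rewrite mem_cat mem_filter c0 eqxx cs.
  have /h : combine i p n \in [seq c : constr <- s | c.1 i == 0] ++
      [seq combine i p n | p <- [seq c : constr <- s | 0 < c.1 i],
        n <- [seq c : constr <- s | c.1 i < 0]].
    rewrite mem_cat; apply/orP; right; apply/allpairsP; exists (p, n).
    by rewrite !mem_filter ap an ps ns.
  by rewrite slack_combine; lra.
rewrite mem_cat mem_filter => /orP[/andP[/eqP c0 cs]|].
  by have := h0 c cs c0; rewrite c0 mul0r subr0.
case/allpairsP=> -[p n] /= [/[!mem_filter]/andP[ap ps] /andP[an ns] ->].
by rewrite slack_combine; have := h1 p n ps ns ap an; lra.
Qed.

(** The projection of the polyhedron to the t-axis is again given by finitely many inequalities; t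
    stays a parameter throughout the elimination. *)
Lemma eliminate_all s : exists s' : seq (R * R), forall t,
  {in s', forall c, c.1 <= c.2 * t} <-> exists q, feasible s q t.
Proof.
(* Generalized to an arbitrary list of eliminated variables, the others being frozen at q. *)
have : exists s', forall q t, feasible s' q t <->
    exists q', (forall i, i \notin enum T -> q' i = q i) /\ feasible s q' t.
  elim: (enum T) => [|i l [s' IH]].
    exists s => q t; split=> [h|[q' [e h]] c /h]; first by exists q.
    by rewrite (@eq_slack c q' q) // => i; rewrite e.
  have [s'' h''] := eliminate i s'; exists s'' => q t; rewrite h''; split.
    case=> x /IH[q' [e h]]; exists q'; split=> // j.
    by rewrite inE negb_or => /andP[ji /e->]; rewrite /upd (negPf ji).
  case=> q' [e h]; exists (q' i); apply/IH; exists q'; split=> // j jl.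
  by rewrite /upd; case: eqVneq => [->//|ji]; apply: e; rewrite inE negb_or ji.
case=> s' h; exists [seq c.2 | c <- s'] => t.
have slack0 c : slack c (fun=> 0) t = c.2.1 - c.2.2 * t.
  by rewrite /slack big1 ?add0r // => i _; rewrite mulr0.
have -> : (exists q, feasible s q t) <-> feasible s' (fun=> 0) t.
  rewrite h; split=> -[q]; last by case=> _ hq; exists q.
  by move=> hq; exists q; split=> // i; rewrite mem_enum.
split=> [h' c cs|h' _ /mapP[c cs ->]].
  by rewrite slack0 subr_le0; apply: h'; apply/mapP; exists c.
by rewrite -subr_le0 -slack0; apply: h'.
Qed.

Lemma max_affine_attains_min (K : finType) (P : pred K) (a : K -> T -> R) (b : K -> R) (c0 : R) :
  let val k q := \sum_i a k i * q i + b k in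
  (forall q, exists2 k, P k & c0 <= val k q) ->
  exists q t, (forall k, P k -> val k q <= t) /\ forall q', exists2 k, P k & t <= val k q'.
Proof.
move=> val lb.
pose s := [seq ([ffun i => a k i], (b k, 1)) : constr | k <- enum P].
have sP q t : feasible s q t <-> forall k, P k -> val k q <= t.
  have slackE k : slack ([ffun i => a k i], (b k, 1)) q t = val k q - t.
    by rewrite /slack /= mul1r; under eq_bigr do rewrite ffunE.
  split=> [h k Pk|h _ /mapP[k /[!mem_enum]Pk ->]].
    by rewrite -subr_le0 -slackE; apply: h; apply/mapP; exists k; rewrite ?mem_enum.
  by rewrite slackE subr_le0 h.
have vmax q : exists2 k, P k & forall k', P k' -> val k' q <= val k q.
  have [k0 Pk0 _] := lb q; exists [arg max_(k > k0 | P k) val k q]%O;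
    by case: arg_maxP => // k Pk kmax k' /kmax.
have [s' s'P] := eliminate_all s.
have [k0 Pk0 k0max] := vmax (fun=> 0).
have feas0 : {in s', forall c, c.1 <= c.2 * val k0 (fun=> 0)}.
  by apply/s'P; exists (fun=> 0); apply/sP.
have lbt t : {in s', forall c, c.1 <= c.2 * t} -> c0 <= t.
  by move=> /s'P[q /sP h]; have [k Pk] := lb q; move=> /le_trans; apply; apply: h.
have [t [tf tmin]] : exists t, {in s', forall c, c.1 <= c.2 * t} /\
    forall t', {in s', forall c, c.1 <= c.2 * t'} -> t <= t'.
  have /hasP[c1 c1s c1pos] : has (fun c => 0 < c.2) s'.
    (* Without a positive coefficient of t, lowering a feasible t keeps all inequalities; [t1] would
       then be feasible below the bound [c0]. *)
    apply: contraT => /hasPn neg; pose t1 := Num.min (c0 - 1) (val k0 (fun=> 0)).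
    suff /lbt : {in s', forall c, c.1 <= c.2 * t1} by rewrite /t1 le_min; lra.
    move=> c cs; apply: (le_trans (feas0 c cs)).
    by rewrite ler_wnM2l ?ge_min ?lexx ?orbT // leNgt; apply: neg.
  (* The minimum is the largest lower bound [c.1 / c.2]. The inequalities with [c.2 <= 0] hold there
     because they hold at a larger feasible value. *)
  pose ratios := [seq c.1 / c.2 | c : R * R <- s' & 0 < c.2].
  have in_ratios c : c \in s' -> 0 < c.2 -> c.1 / c.2 \in ratios.
    by move=> cs cpos; apply/mapP; exists c; rewrite // mem_filter cpos.
  have [|t /mapP[c2 /[!mem_filter]/andP[c2pos c2s] te] /allP tmax] := @ex_maximum ratios.
    by apply/eqP => e; have := in_ratios _ c1s c1pos; rewrite e.
  have le_t t' : {in s', forall c, c.1 <= c.2 * t'} -> t <= t'.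
    by move=> /(_ _ c2s); rewrite te ler_pdivrMr // mulrC.
  exists t; split=> // c cs; have [cpos|cneg] := ltP 0 c.2.
    by have := tmax _ (in_ratios c cs cpos); rewrite /= ler_pdivrMr // mulrC.
  by apply: (le_trans (feas0 c cs)); rewrite ler_wnM2l // le_t.
have [q /sP hq] : exists q, feasible s q t by apply/s'P.
exists q, t; split=> // q'; have [k Pk kmax] := vmax q'; exists k => //.
by apply: tmin; apply/s'P; exists q'; apply/sP.
Qed.
End FourierMotzkin.

(** * Valuated intersection and multiple exchange *)

Section Intersection.
Variables (R : realFieldType) (T : finType).
Implicit Types (D : {set {set T}}) (v : {set T} -> R) (X Y I J A B S : {set T}).

Lemma ex_positive_lower_bound (s : seq R) :
  exists2 e, 0 < e & {in s, forall x, 0 < x -> e <= x}.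
Proof.
elim: s => [|y s [e e0 es]]; first by exists 1.
exists (if 0 < y then Num.min y e else e); first by case: ifP => // y0; rewrite lt_min y0.
move=> x; rewrite inE => /orP[/eqP->|xs] x0; first by rewrite x0 ge_min lexx.
by case: ifP; rewrite ?ge_min es ?orbT.
Qed.

Lemma weightD (q d : T -> R) (e : R) S :
  weight (fun i => q i + e * d i) S = weight q S + e * weight d S.
Proof. by rewrite /weight big_split /= mulr_sumr. Qed.

Lemma weightN (q : T -> R) S : weight (fun i => - q i) S = - weight q S.
Proof. by rewrite /weight sumrN. Qed.

Lemma weight_indicator A S : weight (fun i => (i \in A)%:R : R) S = #|S :&: A|%:R.
Proof.
rewrite /weight (eq_bigr (fun i => if i \in A then 1 else 0)) => [|i _]; last by case: (i \in A).
by rewrite -big_mkcondr /= sumr_const; congr (_ *+ _); apply: eq_card => i; rewrite !inE.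
Qed.

Lemma mnat_intersection D1 D2 (v1 v2 : {set T} -> R) (c : R) : mnat D1 v1 -> mnat D2 v2 ->
  (forall q, exists S1 S2, [/\ S1 \in D1, S2 \in D2 &
     c <= v1 S1 - weight q S1 + (v2 S2 + weight q S2)]) ->
  exists S, [/\ S \in D1, S \in D2 & c <= v1 S + v2 S].
Proof.
move=> m1 m2 weak.
pose K : finType := ({set T} * {set T})%type.
pose P (k : K) := (k.1 \in D1) && (k.2 \in D2).
pose F (k : K) q := v1 k.1 - weight q k.1 + (v2 k.2 + weight q k.2).
pose a (k : K) i : R := (i \in k.2)%:R - (i \in k.1)%:R.
pose b (k : K) := v1 k.1 + v2 k.2.
have valE k q : \sum_i a k i * q i + b k = F k q.
  rewrite (eq_bigr (fun i => (if i \in k.2 then q i else 0) - (if i \in k.1 then q i else 0))).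
    by rewrite sumrB -!weightE /F /b; ring.
  by move=> i _; rewrite /a; case: (i \in k.1); case: (i \in k.2) => /=; ring.
have [|q [t [le_t ge_t]]] := @max_affine_attains_min R T K P a b c.
  move=> q; have [S1 [S2 [S1D S2D le]]] := weak q; exists (S1, S2); first exact/andP.
  by rewrite valE.
have {}le_t k : P k -> F k q <= t by rewrite -valE; apply: le_t.
have {}ge_t q' : exists2 k, P k & t <= F k q'.
  by have [k Pk tk] := ge_t q'; exists k; rewrite -?valE.
have c_le_t : c <= t.
  have [S1 [S2 [S1D S2D le]]] := weak q; apply: (le_trans le).
  by apply: (le_t (S1, S2)); apply/andP.
pose w1 S := v1 S + weight (fun i => - q i) S; pose w2 S := v2 S + weight q S.
have FE S1 S2 : F (S1, S2) q = w1 S1 + w2 S2 by rewrite /F /w1 weightN.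
have g1 := gmatroid_argmaxs (mnat_weight (fun i => - q i) m1).
have g2 := gmatroid_argmaxs (mnat_weight q m2).
rewrite -/w1 -/w2 in g1 g2; set M1 := argmaxs D1 w1 in g1; set M2 := argmaxs D2 w2 in g2.
have [[S1' S2'] /andP[/= S1'D S2'D] t_le] := ge_t q.
have M10 : M1 != set0.
  by have [|S SM] := @argmaxs_ex R T D1 w1; apply/set0Pn; [exists S1' | exists S].
have M20 : M2 != set0.
  by have [|S SM] := @argmaxs_ex R T D2 w2; apply/set0Pn; [exists S2' | exists S].
have tE S1 S2 : S1 \in M1 -> S2 \in M2 -> w1 S1 + w2 S2 = t.
  move=> /argmaxsP[S1D S1m] /argmaxsP[S2D S2m]; apply/eqP; rewrite eq_le -FE.
  rewrite le_t ?[P _]andbC /P /= ?S1D ?S2D //= (le_trans t_le) // !FE.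
  by rewrite lerD ?S1m ?S2m.
(* A pair that reaches the optimum t consists of a maximizer of [w1] and a maximizer of [w2]. *)
have tight S1 S2 : S1 \in D1 -> S2 \in D2 -> t <= w1 S1 + w2 S2 -> S1 \in M1 /\ S2 \in M2.
  move=> S1D S2D le; split; apply/argmaxsP; split=> // S SD.
    by have := le_t (S, S2); rewrite FE /P /= SD S2D => /(_ isT); lra.
  by have := le_t (S1, S); rewrite FE /P /= SD S1D => /(_ isT); lra.
(* A small move of [q] along [d] would bring every pair strictly below the minimum [t]. *)
have no_descent (d : T -> R) : (forall S1 S2, S1 \in M1 -> S2 \in M2 ->
  weight d S2 < weight d S1) -> False.
  move=> dec.
  pose slope (k : K) := weight d k.2 - weight d k.1.
  (* With this e, a pair with value below t stays below t, since the move changes it by at most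
     [e * |slope|]. The summand 1 keeps the denominator positive. *)
  have [e e0 eP] := ex_positive_lower_bound [seq (t - F k q) / (1 + `|slope k|) | k <- enum K].
  have [k Pk] := ge_t (fun i => q i + e * d i); rewrite leNgt => /negP; apply.
  have -> : F k (fun i => q i + e * d i) = F k q + e * slope k.
    by rewrite /F !weightD /slope; ring.
  have [lt|ge] := ltP (F k q) t.
    have n0 : 0 < 1 + `|slope k| by rewrite ltr_pwDl.
    have : e <= (t - F k q) / (1 + `|slope k|).
      apply: eP; first by apply/mapP; exists k; rewrite ?mem_enum.
      by rewrite divr_gt0 // subr_gt0.
    rewrite ler_pdivlMr // => le.
    have : e * slope k <= e * `|slope k| by rewrite ler_pM2l // ler_norm.
    lra.
  move: Pk => /andP[k1 k2]; have [|M1k M2k] := tight k.1 k.2 k1 k2.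
    by rewrite -FE -surjective_pairing.
  have sl0 : slope k < 0 by rewrite subr_lt0 dec.
  have := le_t k; rewrite /P k1 k2 => /(_ isT).
  have : e * slope k < 0 by rewrite pmulr_rlt0.
  lra.
have [dis|] := boolP [disjoint M1 & M2]; last first.
  rewrite -setI_eq0 => /set0Pn[S /setIP[SM1 SM2]]; exists S.
  have /argmaxsP[-> _] := SM1; have /argmaxsP[-> _] := SM2; split=> //.
  by apply: (le_trans c_le_t); rewrite -(tE S S) // /w1 /w2 weightN; lra.
have [S _|A _] := @gmatroid_disjoint_separated T M1 M2 setT set0 g1 g2 M10 M20 dis.
  by rewrite setDT.
case/orP=> sep.
  case: (no_descent (fun i => - (i \in A)%:R)) => S1 S2 S1M S2M.
  rewrite !weightN ltrN2 !weight_indicator ltr_nat.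
  exact: leq_ltn_trans (maxcap_ge A S1M) (leq_trans sep (mincap_le A S2M)).
case: (no_descent (fun i => (i \in A)%:R)) => S1 S2 S1M S2M.
rewrite !weight_indicator ltr_nat.
exact: leq_ltn_trans (maxcap_ge A S2M) (leq_trans sep (mincap_le A S1M)).
Qed.

Lemma mnat_multiple_exchange D v X Y I : mnat D v -> X \in D -> Y \in D ->
  I \subset X :\: Y -> exists J, [/\ J \subset Y :\: X, X :\: I :|: J \in D,
    Y :\: J :|: I \in D & v X + v Y <= v (X :\: I :|: J) + v (Y :\: J :|: I)].
Proof.
move=> mD XD YD sI.
pose D1 := [set J : {set T} | (J \subset Y :\: X) && (X :\: I :|: J \in D)].
pose D2 := [set J : {set T} | (J \subset Y :\: X) && (Y :\: J :|: I \in D)].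
have m1 : mnat D1 (fun J => v (X :\: I :|: J)).
  move=> J1 J2 i /setIdP[s1 J1D] /setIdP[s2 J2D] i1 i2.
  have /setDP[iY iX] := subsetP s1 i i1.
  have [||K [sK K1 KD1 KD2 le]] := mD _ _ i J1D J2D.
  - by rewrite !inE i1 orbT.
  - by rewrite !inE (negPf iX) andbF.
  have e1 : (X :\: I :|: J1) :\: [set i] :|: K = X :\: I :|: (J1 :\: [set i] :|: K).
    apply/setP => z; rewrite !inE; case: (eqVneq z i) => [->|_];
      rewrite ?(negPf iX); bcase; by [].
  have e2 : (X :\: I :|: J2) :\: K :|: [set i] = X :\: I :|: (J2 :\: K :|: [set i]).
    apply/setP => z; move: (subset_implyb z sK); rewrite !inE; bcase; by [].
  rewrite e1 e2 in KD1 KD2 le; exists K; split=> //.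
  - apply/subsetP => z; move: (subset_implyb z sK) (subset_implyb z s2); rewrite !inE; bcase; by [].
  - rewrite inE KD1 andbT; apply/subsetP => z; move: (subset_implyb z sK) (subset_implyb z s1)
      (subset_implyb z s2); rewrite !inE; bcase; by [].
  - rewrite inE KD2 andbT; apply/subsetP => z; move: (subset_implyb z s2); rewrite !inE;
      case: (eqVneq z i) => [->|_]; rewrite ?iX ?iY; bcase; by [].
(* Here J is removed from Y, so an [i] in [J1 :\: J2] belongs to the set built from J2: the exchange
   is applied with J1 and J2 swapped. *)
have m2 : mnat D2 (fun J => v (Y :\: J :|: I)).
  move=> J1 J2 i /setIdP[s1 J1D] /setIdP[s2 J2D] i1 i2.
  have /setDP[iY iX] := subsetP s1 i i1.
  have iI : i \notin I by apply: contra iX => /(subsetP sI); rewrite inE => /andP[].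
  have [||K [sK K1 KD1 KD2 le]] := mD _ _ i J2D J1D.
  - by rewrite !inE i2 iY.
  - by rewrite !inE i1 (negPf iI).
  have e1 : (Y :\: J2 :|: I) :\: [set i] :|: K = Y :\: (J2 :\: K :|: [set i]) :|: I.
    apply/setP => z; move: (subset_implyb z sK) (subset_implyb z s2); rewrite !inE;
      case: (eqVneq z i) => [->|_]; rewrite ?i1 ?(negPf iI) ?(negPf i2); bcase; by [].
  have e2 : (Y :\: J1 :|: I) :\: K :|: [set i] = Y :\: (J1 :\: [set i] :|: K) :|: I.
    apply/setP => z; move: (subset_implyb z sK); rewrite !inE;
      case: (eqVneq z i) => [->|_]; rewrite ?i1 ?iY ?(negPf iI) ?(negPf i2); bcase; by [].
  rewrite e1 e2 in KD1 KD2 le; exists K; split=> //; last by rewrite addrC [leRHS]addrC.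
  - apply/subsetP => z; move: (subset_implyb z sK); rewrite !inE; bcase; by [].
  - rewrite inE KD2 andbT; apply/subsetP => z; move: (subset_implyb z sK) (subset_implyb z s1)
      (subset_implyb z s2); rewrite !inE; bcase; by [].
  - rewrite inE KD1 andbT; apply/subsetP => z; move: (subset_implyb z s2); rewrite !inE;
      case: (eqVneq z i) => [->|_]; rewrite ?iX ?iY; bcase; by [].
have [q|J [/setIdP[sJ JD1] /setIdP[_ JD2] le]] := @mnat_intersection D1 D2 _ _ (v X + v Y) m1 m2;
  last by exists J.
(* Between the intersection and the union of X and Y, the sets S and U given by [weak_exchange] have
   the forms [X :\: I :|: J1] and [Y :\: J2 :|: I]. The price -q on T then contributes -q on J1 and,
   since J2 is removed, +q on J2. *)
have XB : X \in between D (X :&: Y) (X :|: Y) by rewrite inE XD subsetIl subsetUl.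
have YB : Y \in between D (X :&: Y) (X :|: Y) by rewrite inE YD subsetIr subsetUr.
have [S [U [/setIdP[SD /andP[lS uS]] /setIdP[UD /andP[lU uU]] SE UE]]] :=
  weak_exchange (mnat_weight (fun i => - q i) (mnat_between (A := X :&: Y) (B :=
    X :|: Y) mD)) XB YB sI.
have Sz z := subset_implyb z lS; have Sz' z := subset_implyb z uS.
have Uz z := subset_implyb z lU; have Uz' z := subset_implyb z uU.
have SEz z : (z \in S :&: (X :\: Y)) = (z \in X :\: Y :\: I) by rewrite SE.
have UEz z : (z \in U :&: (X :\: Y)) = (z \in I) by rewrite UE.
pose J1 := S :&: (Y :\: X); pose J2 := (Y :\: X) :\: U.
have eS : X :\: I :|: J1 = S.
  apply/setP => z; move: (Sz z) (Sz' z) (SEz z) (subset_implyb z sI); rewrite !inE; bcase; by [].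
have eU : Y :\: J2 :|: I = U.
  apply/setP => z; move: (Uz z) (Uz' z) (UEz z) (subset_implyb z sI); rewrite !inE; bcase; by [].
rewrite !weightN => le.
exists J1, J2; split; rewrite ?inE ?eS ?eU ?SD ?UD ?subsetIr ?subsetDl //.
suff : weight q X + weight q Y - weight q S - weight q U = weight q J2 - weight q J1 by lra.
rewrite !weightE -!sumrN -!big_split /=; apply: eq_bigr => z _.
move: (Sz z) (Sz' z) (SEz z) (Uz z) (Uz' z) (UEz z) (subset_implyb z sI).
rewrite !inE; bcase => //= *; lra.
Qed.
End Intersection.

(** * Single exchange from multiple exchange *)

Section MultipleToSingle.
Variables (R : realFieldType) (T : finType) (D : {set {set T}}) (v : {set T} -> R).
Implicit Types (X Y I J A B S Z : {set T}).

Definition mult_exchange := forall X Y I, X \in D -> Y \in D -> I \subset X :\: Y ->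
  exists J, [/\ J \subset Y :\: X, X :\: I :|: J \in D,
    Y :\: J :|: I \in D & v X + v Y <= v (X :\: I :|: J) + v (Y :\: J :|: I)].

Hypothesis mex : mult_exchange.

Definition exchange_to X Y X' Y' := [/\ X' \in D, Y' \in D & v X + v Y <= v X' + v Y'].

(** Four bits select which of a, b, c, d are added to Z, so that exchanges among the sixteen sets
    become a finite case analysis by computation. *)
Definition pt Z (a b c d : T) (x1 x2 x3 x4 : bool) :=
  Z :|: [set t | [|| x1 && (t == a), x2 && (t == b), x3 && (t == c) | x4 && (t == d)]].

Section Four.
Variables (Z : {set T}) (a b c d : T).
Hypotheses (abcd : uniq [:: a; b; c; d])
  (aZ : a \notin Z) (bZ : b \notin Z) (cZ : c \notin Z) (dZ : d \notin Z).
Let ptz := pt Z a b c d.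

Lemma mem_pt t x1 x2 x3 x4 : (t \in ptz x1 x2 x3 x4) =
  if t == a then x1 else if t == b then x2 else if t == c then x3 else if t == d then x4
  else t \in Z.
Proof.
move: abcd; rewrite /= ?inE ?negb_or ?andbT => /and3P[/and3P[ab ac ad] /andP[bc bd] cd].
rewrite /ptz /pt ?inE.
case: (eqVneq t a) => [->|_].
  by rewrite (negPf aZ) (negPf ab) (negPf ac) (negPf ad); move: x1 x2 x3 x4 => [] [] [] [].
case: (eqVneq t b) => [->|_].
  by rewrite (negPf bZ) (negPf bc) (negPf bd); move: x1 x2 x3 x4 => [] [] [] [].
case: (eqVneq t c) => [->|_].
  by rewrite (negPf cZ) (negPf cd); move: x1 x2 x3 x4 => [] [] [] [].
case: (eqVneq t d) => [->|_].
  by rewrite (negPf dZ); move: x1 x2 x3 x4 => [] [] [] [].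
by case: (t \in Z); move: x1 x2 x3 x4 => [] [] [] [].
Qed.

(** Multiple exchange in bits: the r's describe I and the s's describe J. *)
Lemma pt_exchange p1 p2 p3 p4 q1 q2 q3 q4 r1 r2 r3 r4 :
  ptz p1 p2 p3 p4 \in D -> ptz q1 q2 q3 q4 \in D ->
  [&& r1 ==> p1 && ~~ q1, r2 ==> p2 && ~~ q2, r3 ==> p3 && ~~ q3 & r4 ==> p4 && ~~ q4] ->
  exists s1 s2 s3 s4,
  [&& s1 ==> q1 && ~~ p1, s2 ==> q2 && ~~ p2, s3 ==> q3 && ~~ p3 & s4 ==> q4 && ~~ p4] /\
  exchange_to (ptz p1 p2 p3 p4) (ptz q1 q2 q3 q4)
    (ptz (p1 && ~~ r1 || s1) (p2 && ~~ r2 || s2) (p3 && ~~ r3 || s3) (p4 && ~~ r4 || s4))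
    (ptz (q1 && ~~ s1 || r1) (q2 && ~~ s2 || r2) (q3 && ~~ s3 || r3) (q4 && ~~ s4 || r4)).
Proof.
move=> pD qD /and4P[/implyP h1 /implyP h2 /implyP h3 /implyP h4].
move: abcd; rewrite /= ?inE ?negb_or ?andbT => /and3P[/and3P[ab ac ad] /andP[bc bd] cd].
have [ba [ca da]] : [/\ b != a, c != a & d != a] by rewrite !(eq_sym _ a).
have [[cb db] dc] : (c != b /\ d != b) /\ d != c by rewrite !(eq_sym _ b) (eq_sym d).
pose simp := (eqxx, negPf ab, negPf ac, negPf ad, negPf bc, negPf bd, negPf cd,
  negPf ba, negPf ca, negPf da, negPf cb, negPf db, negPf dc).
pose I := [set t | [|| r1 && (t == a), r2 && (t == b), r3 && (t == c) | r4 && (t == d)]].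
have [|J [sJ D1 D2 le]] := mex (I := I) pD qD.
  apply/subsetP => t; rewrite in_setD !mem_pt inE.
  case/or4P=> /andP[r /eqP->]; rewrite !simp andbC; by [apply: h1|apply: h2|apply: h3|apply: h4].
have Jt t : (t \in J) ==> (t \notin ptz p1 p2 p3 p4) && (t \in ptz q1 q2 q3 q4).
  by rewrite -in_setD; apply: subset_implyb.
exists (a \in J), (b \in J), (c \in J), (d \in J); split.
  by move: (Jt a) (Jt b) (Jt c) (Jt d); rewrite !mem_pt !simp ![~~ _ && _]andbC => -> -> -> ->.
have memI t : (t \in I) = if t == a then r1 else if t == b then r2 else if t == c then r3
    else if t == d then r4 else false.
  rewrite ?inE; case: (eqVneq t a) => [->|_].
    by rewrite !simp; move: (r1) (r2) (r3) (r4) => [] [] [] [].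
  case: (eqVneq t b) => [->|_].
    by rewrite !simp; move: (r1) (r2) (r3) (r4) => [] [] [] [].
  case: (eqVneq t c) => [->|_].
    by rewrite !simp; move: (r1) (r2) (r3) (r4) => [] [] [] [].
  by case: (eqVneq t d) => _; move: (r1) (r2) (r3) (r4) => [] [] [] [].
have e1 : ptz p1 p2 p3 p4 :\: I :|: J =
    ptz (p1 && ~~ r1 || (a \in J)) (p2 && ~~ r2 || (b \in J))
        (p3 && ~~ r3 || (c \in J)) (p4 && ~~ r4 || (d \in J)).
  apply/setP => t; move: (Jt t); rewrite in_setU in_setD !mem_pt memI.
  case: (eqVneq t a) => [->|_]; first by move=> _; rewrite andbC.
  case: (eqVneq t b) => [->|_]; first by move=> _; rewrite andbC.
  case: (eqVneq t c) => [->|_]; first by move=> _; rewrite andbC.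
  case: (eqVneq t d) => [->|_]; first by move=> _; rewrite andbC.
  by bcase.
have e2 : ptz q1 q2 q3 q4 :\: J :|: I =
    ptz (q1 && ~~ (a \in J) || r1) (q2 && ~~ (b \in J) || r2)
        (q3 && ~~ (c \in J) || r3) (q4 && ~~ (d \in J) || r4).
  apply/setP => t; move: (Jt t); rewrite in_setU in_setD !mem_pt memI.
  case: (eqVneq t a) => [->|_]; first by move=> _; rewrite andbC.
  case: (eqVneq t b) => [->|_]; first by move=> _; rewrite andbC.
  case: (eqVneq t c) => [->|_]; first by move=> _; rewrite andbC.
  case: (eqVneq t d) => [->|_]; first by move=> _; rewrite andbC.
  by bcase.
by rewrite -e1 -e2.
Qed.

(* Write the four sets as 12 | 34. If neither 23 | 14 nor 24 | 13 is good enough, then both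
   134 | 2 and 234 | 1 are, and adding f(134) + f(1) <= f(14) + f(13) and
   f(234) + f(2) <= f(24) + f(23) gives a contradiction. *)
Lemma four_point : let f := ptz in
  f true true false false \in D -> f false false true true \in D ->
  exchange_to (f true true false false) (f false false true true)
    (f false true true false) (f true false false true) \/
  exchange_to (f true true false false) (f false false true true)
    (f false true false true) (f true false true false).
Proof.
move=> f D12 D34.
pose S := v (f true true false false) + v (f false false true true).
pose ge A B := [&& A \in D, B \in D & S <= v A + v B].
suff : ge (f false true true false) (f true false false true) ||
       ge (f false true false true) (f true false true false).
  by case/orP=> /and3P[]; [left|right].
apply: contraT; rewrite negb_or => /andP[no1 no2].
(* The same exclusion with the two sets swapped, in the order that the steps below produce. *)
have no1' : ~~ ge (f true false false true) (f false true true false).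
  by apply: contra no1 => /and3P[? ?]; rewrite /ge addrC => ->; apply/and3P.
have step p1 p2 p3 p4 q1 q2 q3 q4 r1 r2 r3 r4 : ge (f p1 p2 p3 p4) (f q1 q2 q3 q4) ->
    [&& r1 ==> p1 && ~~ q1, r2 ==> p2 && ~~ q2, r3 ==> p3 && ~~ q3 & r4 ==> p4 && ~~ q4] ->
    exists s1 s2 s3 s4,
    [&& s1 ==> q1 && ~~ p1, s2 ==> q2 && ~~ p2, s3 ==> q3 && ~~ p3 & s4 ==> q4 && ~~ p4] /\
    ge (f (p1 && ~~ r1 || s1) (p2 && ~~ r2 || s2) (p3 && ~~ r3 || s3) (p4 && ~~ r4 || s4))
       (f (q1 && ~~ s1 || r1) (q2 && ~~ s2 || r2) (q3 && ~~ s3 || r3) (q4 && ~~ s4 || r4)).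
  move=> /and3P[pD qD le] cond.
  have [s1 [s2 [s3 [s4 [sc [D1 D2 le']]]]]] := pt_exchange pD qD cond.
  by exists s1, s2, s3, s4; split=> //; apply/and3P; split=> //; apply: le_trans le'.
(* Each of the four steps moves one element from a three-element side. If nothing comes back, the
   result is an excluded pairing; otherwise the single element of the other side comes back. *)
have stepA : ge (f true false true true) (f false true false false) ->
    ge (f true true false true) (f false false true false).
  move=> h; have [[] [[] [[] [[] [//= _]]]]] := step _ _ _ _ _ _ _ _ false false true false h isT;
    by rewrite // (negPf no1').
have stepB : ge (f true true false true) (f false false true false) ->
    ge (f false true true true) (f true false false false).
  move=> h; have [[] [[] [[] [[] [//= _]]]]] := step _ _ _ _ _ _ _ _ true false false false h isT;
    by rewrite // (negPf no2).
have stepC : ge (f false true true true) (f true false false false) ->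
    ge (f true true false true) (f false false true false).
  move=> h; have [[] [[] [[] [[] [//= _]]]]] := step _ _ _ _ _ _ _ _ false false true false h isT;
    by rewrite // (negPf no2).
have stepD : ge (f true true false true) (f false false true false) ->
    ge (f true false true true) (f false true false false).
  move=> h; have [[] [[] [[] [[] [//= _]]]]] := step _ _ _ _ _ _ _ _ false true false false h isT;
    by rewrite // (negPf no1').
have g0 : ge (f true true false false) (f false false true true) by rewrite /ge D12 D34 lexx.
have g124 : ge (f true true false true) (f false false true false).
  have [[] [[] [[] [[] [//= _]]]]] := step _ _ _ _ _ _ _ _ true false false false g0 isT.
  - by rewrite (negPf no1).
  - by rewrite (negPf no2).
  - by move=> /and3P[? ? h]; apply: stepA; rewrite /ge addrC; apply/and3P.
have /and3P[D134 D2 le2] := stepD g124; have /and3P[D234 D1 le1] := stepB g124.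
have [[] [[] [[] [[] [//= _ [D14 D13 le3]]]]]] := pt_exchange (r1 := false) (r2 := false)
  (r3 := true) (r4 := false) D134 D1 isT.
have [[] [[] [[] [[] [//= _ [D24 D23 le4]]]]]] := pt_exchange (r1 := false) (r2 := false)
  (r3 := true) (r4 := false) D234 D2 isT.
move: no1 no2; rewrite /ge /f D14 D13 D23 D24 /= -!ltNge.
move: le1 le2 le3 le4; rewrite /f; lra.
Qed.

End Four.

Lemma subset_le1 A B : (#|B| <= 1)%N -> A \subset B -> A = set0 \/ A = B.
Proof.
move=> B1 sAB; have [|n0] := eqVneq A set0; first by left.
by right; apply/eqP; rewrite eqEcard sAB (leq_trans B1) // card_gt0.
Qed.

Lemma exchange_toC X Y X' Y' : exchange_to X Y X' Y' -> exchange_to X Y Y' X'.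
Proof. by case=> ? ? le; split; rewrite // [leRHS]addrC. Qed.

Lemma mex_to X Y I : X \in D -> Y \in D -> I \subset X :\: Y ->
  exists2 J : {set T}, J \subset Y :\: X & exchange_to X Y (X :\: I :|: J) (Y :\: J :|: I).
Proof. by move=> XD YD sI; have [J [sJ ? ? ?]] := mex XD YD sI; exists J. Qed.

(** Move J0 from Y to B. Only [i] can come back, and the two outcomes are whether it does. *)
Lemma exchange_one_two Y i J0 J : let B := Y :\: (J0 :|: J) :|: [set i] in
  Y \in D -> B \in D -> i \notin Y -> J0 \subset Y -> J \subset Y -> [disjoint J0 & J] ->
  exchange_to Y B (Y :\: J0) (Y :\: J :|: [set i]) \/
  exchange_to Y B (Y :\: J0 :|: [set i]) (Y :\: J).
Proof.
move=> B YD BD iY s0 s dis.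
have dz z : (z \in J0) ==> (z \notin J) by apply/implyP => /(disjointFr dis)->.
have iJ0 : i \notin J0 by apply: contra iY; apply/subsetP.
have iJ : i \notin J by apply: contra iY; apply/subsetP.
have [|K sK ex] := @mex_to Y B J0 YD BD.
  apply/subsetP => z; move: (subset_implyb z s0) (dz z); rewrite !inE.
  by case: (eqVneq z i) => [->|_]; rewrite ?(negPf iJ0); bcase.
have {}sK : K \subset [set i].
  by apply/subsetP => z; move: (subset_implyb z sK); rewrite !inE; bcase.
have [||] := subset_le1 _ sK => [|K0|Ki]; first by rewrite cards1.
- left; move: ex; rewrite K0 setU0 setD0.
  suff -> : B :|: J0 = Y :\: J :|: [set i] by [].
  apply/setP => z; move: (subset_implyb z s0) (dz z); rewrite !inE; bcase; by [].
right; move: ex; rewrite Ki.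
suff -> : B :\: [set i] :|: J0 = Y :\: J by [].
apply/setP => z; move: (subset_implyb z s0) (dz z); rewrite !inE.
by case: (eqVneq z i) => [->|_]; rewrite ?(negPf iJ0) ?(negPf iY); bcase.
Qed.

(** Move [i] from B to Y. Only L can come back, and it has at most one element. *)
Lemma exchange_two_small Y i0 i L : let B := Y :\: L :|: [set i0; i] in
  Y \in D -> B \in D -> i0 \notin Y -> i \notin Y -> i0 != i -> L \subset Y -> (#|L| <= 1)%N ->
  exchange_to Y B (Y :\: L :|: [set i0]) (Y :|: [set i]) \/
  exchange_to Y B (Y :|: [set i0]) (Y :\: L :|: [set i]).
Proof.
move=> B YD BD i0Y iY ne sL L1.
have i0L : i0 \notin L by apply: contra i0Y; apply/subsetP.
have iL : i \notin L by apply: contra iY; apply/subsetP.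
have [|K sK [K1 K2 le]] := @mex_to B Y [set i] BD YD.
  by rewrite sub1set !inE eqxx (negPf iY) !orbT.
have {}sK : K \subset L.
  by apply/subsetP => z; move: (subset_implyb z sK); rewrite !inE; bcase.
have {K1 K2}ex : exchange_to Y B (B :\: [set i] :|: K) (Y :\: K :|: [set i]).
  by split; rewrite // addrC.
have e1 : B :\: [set i] = Y :\: L :|: [set i0].
  apply/setP => z; rewrite !inE; case: (eqVneq z i) => [->|_].
    by rewrite (negPf iY) [i == i0]eq_sym (negPf ne) ?andbF.
  by bcase.
have [K0|KL] := subset_le1 L1 sK; first by left; move: ex; rewrite K0 setU0 setD0 e1.
right; move: ex; rewrite KL e1.
suff -> : Y :\: L :|: [set i0] :|: L = Y :|: [set i0] by [].
by apply/setP => z; move: (subset_implyb z sL); rewrite !inE; bcase.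
Qed.

(** The two ways to pair [i0] and [i] with J0 and J. Two singletons are the case of [four_point]; if
    one of the sets is empty, [exchange_two_small] applies. *)
Lemma exchange_two_two Y i0 i J0 J : let B := Y :\: (J0 :|: J) :|: [set i0; i] in
  Y \in D -> B \in D -> i0 \notin Y -> i \notin Y -> i0 != i ->
  J0 \subset Y -> J \subset Y -> [disjoint J0 & J] -> (#|J0| <= 1)%N -> (#|J| <= 1)%N ->
  exchange_to Y B (Y :\: J0 :|: [set i0]) (Y :\: J :|: [set i]) \/
  exchange_to Y B (Y :\: J0 :|: [set i]) (Y :\: J :|: [set i0]).
Proof.
move=> B YD BD i0Y iY ne s0 s dis c0 c.
have [e0|/set0Pn[j0 j0J]] := eqVneq J0 set0.
  move: BD; rewrite /B e0 set0U setD0 => BD.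
  have [ex|ex] := exchange_two_small YD BD i0Y iY ne s c; [right|left] => //.
  exact: exchange_toC.
have [e1|/set0Pn[j jJ]] := eqVneq J set0.
  move: BD; rewrite /B e1 setU0 setD0 => BD.
  have [ex|ex] := exchange_two_small YD BD i0Y iY ne s0 c0; [left|right] => //.
  exact: exchange_toC.
have s0' := s0; have {}s0 : [set j0] \subset J0 by rewrite sub1set.
have E0 : J0 = [set j0].
  by case: (subset_le1 c0 s0) => [/setP/(_ j0)|->]; rewrite ?inE ?eqxx.
have sj : [set j] \subset J by rewrite sub1set.
have E1 : J = [set j].
  by case: (subset_le1 c sj) => [/setP/(_ j)|->]; rewrite ?inE ?eqxx.
have jY : j \in Y by apply: (subsetP s).
have j0Y : j0 \in Y by apply: (subsetP s0').
have jj0 : j != j0 by apply: contraTneq jJ => ->; rewrite (disjointFr dis).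
have [i0j0 i0j] : i0 != j0 /\ i0 != j by split; apply: contraNneq i0Y => ->.
have [ij0 ij] : i != j0 /\ i != j by split; apply: contraNneq iY => ->.
pose Z := Y :\: (J0 :|: J).
pose simp := (eqxx, negPf i0Y, negPf iY, jY, j0Y, negPf jj0, negPf i0j0, negPf i0j, negPf ij0,
  negPf ij, negPf ne, etrans (eq_sym _ _) (negPf jj0), etrans (eq_sym _ _) (negPf i0j0),
  etrans (eq_sym _ _) (negPf i0j), etrans (eq_sym _ _) (negPf ij0),
  etrans (eq_sym _ _) (negPf ij), etrans (eq_sym _ _) (negPf ne)).
have uni : uniq [:: j0; j; i0; i] by rewrite /= !inE !simp.
have [zj0 zj zi0 zi] : [/\ j0 \notin Z, j \notin Z, i0 \notin Z & i \notin Z].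
  by rewrite !inE j0J jJ (negPf i0Y) (negPf iY) !andbF orbT.
have ptE x1 x2 x3 x4 A : (j0 \in A) = x1 -> (j \in A) = x2 -> (i0 \in A) = x3 ->
    (i \in A) = x4 -> (forall z, z != j0 -> z != j -> z != i0 -> z != i ->
      (z \in A) = (z \in Y)) -> pt Z j0 j i0 i x1 x2 x3 x4 = A.
  move=> m1 m2 m3 m4 m; apply/setP => z; rewrite mem_pt //.
  case: (eqVneq z j0) => [->//|zj0']; case: (eqVneq z j) => [->//|zj'].
  case: (eqVneq z i0) => [->//|zi0']; case: (eqVneq z i) => [->//|zi'].
  by rewrite m // !inE E0 E1 !inE (negPf zj0') (negPf zj').
have pY : pt Z j0 j i0 i true true false false = Y by apply: ptE; rewrite ?simp.
have pB : pt Z j0 j i0 i false false true true = B.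
  apply: ptE; rewrite ?inE ?E0 ?E1 ?inE ?simp //= => z /negPf h1 /negPf h2 /negPf h3 /negPf h4.
  by rewrite ?inE ?E0 ?E1 ?inE ?h1 ?h2 ?h3 ?h4 /= ?orbF.
have p1 : pt Z j0 j i0 i false true true false = Y :\: J0 :|: [set i0].
  apply: ptE; rewrite ?inE ?E0 ?E1 ?inE ?simp //= => z /negPf h1 /negPf h2 /negPf h3 /negPf h4.
  by rewrite !inE h1 h3 orbF.
have p2 : pt Z j0 j i0 i true false false true = Y :\: J :|: [set i].
  apply: ptE; rewrite ?inE ?E0 ?E1 ?inE ?simp //= => z /negPf h1 /negPf h2 /negPf h3 /negPf h4.
  by rewrite !inE h2 h4 orbF.
have p3 : pt Z j0 j i0 i false true false true = Y :\: J0 :|: [set i].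
  apply: ptE; rewrite ?inE ?E0 ?E1 ?inE ?simp //= => z /negPf h1 /negPf h2 /negPf h3 /negPf h4.
  by rewrite !inE h1 h4 orbF.
have p4 : pt Z j0 j i0 i true false true false = Y :\: J :|: [set i0].
  apply: ptE; rewrite ?inE ?E0 ?E1 ?inE ?simp //= => z /negPf h1 /negPf h2 /negPf h3 /negPf h4.
  by rewrite !inE h2 h3 orbF.
have := four_point uni zj0 zj zi0 zi; rewrite /= pY pB p1 p2 p3 p4.
exact.
Qed.

(** Move one j of J from Y to the other set. If nothing comes back, J has shrunk; if [i] comes back,
    [[set j]] already works. *)
Lemma reduce_to_one Y i J : Y \in D -> i \notin Y -> J \subset Y ->
  Y :\: J :|: [set i] \in D ->
  exists J1, [/\ J1 \subset J, (#|J1| <= 1)%N & Y :\: J1 :|: [set i] \in D].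
Proof.
move=> YD iY; have [n] := ubnP #|J|; elim: n => // n IHn in J *.
move=> /ltnSE leJ sJ BD.
have [J1|J2] := leqP #|J| 1; first by exists J.
have /set0Pn[j jJ] : J != set0 by rewrite -card_gt0 ltnW.
have ij : i \notin J by apply: contra iY; apply/subsetP.
have jY : j \in Y by apply: (subsetP sJ).
have ji : j != i by apply: contraNneq iY => <-.
have [|K sK [K1 K2 _]] := @mex_to Y (Y :\: J :|: [set i]) [set j] YD BD.
  by rewrite sub1set !inE jJ jY (negPf ji).
have {}sK : K \subset [set i].
  by apply/subsetP => z; move: (subset_implyb z sK); rewrite !inE; bcase.
have [||] := subset_le1 _ sK => [|K0|Ki]; first by rewrite cards1.
  have [||| J1 [sJ1 c1 J1D]] := IHn (J :\ j).
  - by move: leJ; rewrite (cardsD1 j J) jJ.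
  - by rewrite (subset_trans _ sJ) ?subsetDl.
  - suff -> : Y :\: (J :\ j) :|: [set i] = (Y :\: J :|: [set i]) :\: K :|: [set j].
      by [].
    rewrite K0 setD0; apply/setP => z; rewrite !inE; case: (eqVneq z j) => [->|_].
      by rewrite jY orbT.
    by bcase.
  by exists J1; split=> //; rewrite (subset_trans sJ1) ?subsetDl.
by exists [set j]; rewrite sub1set jJ cards1 -{1}Ki.
Qed.

Section Potential.
Variables (X Y : {set T}) (i : T).
Hypotheses (XD : X \in D) (YD : Y \in D) (iX : i \in X) (iY : i \notin Y).
Hypothesis violation : forall J, J \subset Y :\: X -> (#|J| <= 1)%N ->
  X :\: [set i] :|: J \in D -> Y :\: J :|: [set i] \in D ->
  v (X :\: [set i] :|: J) + v (Y :\: J :|: [set i]) < v X + v Y.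

(* Only the values of [q] at [i] and on [Y :\: X] matter: the violated inequalities leave room
   for each difference [q j - q i], and [q i] is very negative if [X - i] is not in the domain. *)
Lemma potential : exists q, let h S := v S + weight q S in
  [/\ forall J, J \subset Y :\: X -> (#|J| <= 1)%N -> X :\: [set i] :|: J \in D ->
        h (X :\: [set i] :|: J) <= h X,
      forall J, J \subset Y :\: X -> (#|J| <= 1)%N -> Y :\: J :|: [set i] \in D ->
        h (Y :\: J :|: [set i]) < h Y &
      forall j, j \in Y :\: X -> j |: X \in D -> h (j |: X) <= h X].
Proof.
pose Xj J := X :\: [set i] :|: J; pose Yj J := Y :\: J :|: [set i].
(* [delta j] is the difference of the prices of j and [i]. It makes X - i + j tie with X if the
   former is in D, and otherwise puts Y - j + i one below Y. In the first case the violation gives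
   the strict loss for Y. *)
pose delta j := if Xj [set j] \in D then v X - v (Xj [set j]) else v (Yj [set j]) - v Y + 1.
have [qneg /= /andP[qY /allP qj]] := @ex_lower_bound R
  (v Y - v (Yj set0) - 1 :: [seq v X - v (j |: X) - delta j | j <- enum (Y :\: X)]).
pose qi := if Xj set0 \in D then v (Xj set0) - v X else qneg.
pose q z := if z == i then qi else qi + delta z.
have qE : q i = qi by rewrite /q eqxx.
have qjE j : j \in Y :\: X -> q j = qi + delta j.
  by move=> /setDP[_ jX]; rewrite /q; case: eqVneq => // e; rewrite e iX in jX.
have w1 (j : T) : weight q [set j] = q j by rewrite /weight big_set1.
have wX J : J \subset Y :\: X -> weight q (Xj J) = weight q X - qi + weight q J.
  move=> sJ; rewrite -qE -w1 !weightE -sumrN -!big_split /=; apply: eq_bigr => z _.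
  move: (subset_implyb z sJ); rewrite !inE; case: (eqVneq z i) => [->|_]; rewrite ?iX;
    bcase => //= *; lra.
have wY J : J \subset Y :\: X -> weight q (Yj J) = weight q Y - weight q J + qi.
  move=> sJ; rewrite -qE -w1 !weightE -sumrN -!big_split /=; apply: eq_bigr => z _.
  move: (subset_implyb z sJ); rewrite !inE; case: (eqVneq z i) => [->|_];
    rewrite ?(negPf iY); bcase => //= *; lra.
have w0 : weight q set0 = 0 by rewrite /weight big_set0.
have small J : J \subset Y :\: X -> (#|J| <= 1)%N -> J = set0 \/ exists2 j,
  j \in Y :\: X & J = [set j].
  move=> sJ; case: (set_0Vmem J) => [->|[j jJ] J1]; first by left.
  right; exists j; first exact: (subsetP sJ).
  by have [|/setP/(_ j)|<-//] := @subset_le1 [set j] J J1; rewrite ?sub1set // !inE eqxx.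
have viol0 := @violation set0 (sub0set _); rewrite cards0 in viol0.
exists q; split.
- move=> J sJ J1 XJD; rewrite wX //.
  have [J0|[j jW Jj]] := small J sJ J1; subst J.
    by rewrite w0 /qi -/(Xj _) XJD; lra.
  by rewrite w1 qjE // /delta -/(Xj _) XJD; lra.
- move=> J sJ J1 YJD; rewrite wY //.
  have [J0|[j jW Jj]] := small J sJ J1; subst J.
    rewrite w0 /qi -/(Yj _); case: ifP => [X0D|_]; last by rewrite -/(Yj _) in qY *; lra.
    by have := viol0 isT X0D YJD; rewrite -/(Xj _) -/(Yj _); lra.
  rewrite w1 qjE // /delta -/(Yj _); case: ifP => [XjD|_]; last by lra.
  by have := violation sJ J1 XjD YJD; rewrite -/(Xj _) -/(Yj _); lra.
move=> j jW jXD; have /setDP[jY jX] := jW.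
have wjX : weight q (j |: X) = q j + weight q X by rewrite /weight big_setU1.
rewrite wjX qjE //; case: (boolP (Xj set0 \in D)) => X0D; last first.
  have : qneg <= v X - v (j |: X) - delta j by apply: qj; apply/mapP; exists j; rewrite ?mem_enum.
  by rewrite /qi (negPf X0D); lra.
have ji : j != i by apply: contraNneq jX => ->.
(* Moving j from X + j to X - i, nothing can come back, so the results are X and X - i + j; this
   inequality is the claim after inserting the prices. *)
have [|K sK [K1 K2 le]] := @mex_to (j |: X) (Xj set0) [set j] jXD X0D.
  by rewrite sub1set !inE eqxx (negPf jX) andbF.
have {}sK : K = set0.
  apply/eqP; rewrite -subset0; apply/subsetP => z; move: (subset_implyb z sK).
  by rewrite !inE; bcase.
have e1 : (j |: X) :\: [set j] :|: K = X.
  apply/setP => z; rewrite sK !inE; case: (eqVneq z j) => [->|_]; rewrite ?(negPf jX); bcase; by [].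
have e2 : Xj set0 :\: K :|: [set j] = Xj [set j] by rewrite sK setD0 /Xj setU0.
rewrite e1 e2 in K2 le; rewrite /qi X0D /delta K2; lra.
Qed.
End Potential.


End MultipleToSingle.

(** * Violations at minimal distance *)

Section MinimalViolation.
Variables (R : realFieldType) (T : finType) (D : {set {set T}}) (v : {set T} -> R).
Implicit Types (X Y I J A B S Z W : {set T}).

Lemma mult_exchange_weight q :
  mult_exchange D v -> mult_exchange D (fun S => v S + weight q S).
Proof.
move=> mex X Y I XD YD sI; have [J [sJ D1 D2 le]] := mex X Y I XD YD sI.
by exists J; split=> //; have := weight_exchange q sI sJ; lra.
Qed.

Lemma best_removal Y W A (h : {set T} -> R) :
  (exists J : {set T}, [/\ J \subset W, (#|J| <= 1)%N & Y :\: J :|: A \in D]) ->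
  exists J0 : {set T}, [/\ J0 \subset W, (#|J0| <= 1)%N, Y :\: J0 :|: A \in D &
    forall J : {set T}, J \subset W -> (#|J| <= 1)%N -> Y :\: J :|: A \in D ->
      h (Y :\: J :|: A) <= h (Y :\: J0 :|: A)].
Proof.
pose P J := [&& J \subset W, (#|J| <= 1)%N & Y :\: J :|: A \in D].
case=> J1 [sJ1 c1 J1D]; have PJ1 : P J1 by apply/and3P.
exists [arg max_(J > J1 | P J) h (Y :\: J :|: A)]%O.
case: arg_maxP => // J0 /and3P[s0 c0 J0D] mx; split=> // J sJ cJ JD.
by apply: mx; apply/and3P.
Qed.

(* For a violation (X, Y, i) with X and Y closest, the potentials yield a set Y' closer to X
   than Y, and the exchange properties between Y and Y' + i - j make (X, Y', i) a violation. *)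
Theorem mult_exchange_mnat : mult_exchange D v -> mnat D v.
Proof.
move=> mex X Y i; have [n] := ubnP (#|X :\: Y| + #|Y :\: X|)%N.
elim: n => // n IHn in Y *; move=> /ltnSE len XD YD iX iY.
pose good J := [&& J \subset Y :\: X, (#|J| <= 1)%N, X :\: [set i] :|: J \in D,
  Y :\: J :|: [set i] \in D & v X + v Y <= v (X :\: [set i] :|: J) + v (Y :\: J :|: [set i])].
have [/existsP[J /and5P[]]|/existsPn bad] := boolP [exists J, good J]; first by exists J.
have viol J : J \subset Y :\: X -> (#|J| <= 1)%N ->
    X :\: [set i] :|: J \in D -> Y :\: J :|: [set i] \in D ->
    v (X :\: [set i] :|: J) + v (Y :\: J :|: [set i]) < v X + v Y.
  by move=> sJ cJ XJ YJ; have := bad J; rewrite /good sJ cJ XJ YJ /= ltNge.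
have [q [hX hY hXj]] := potential mex iX iY viol.
pose h S := v S + weight q S.
exfalso.
(* The induction hypothesis provides an exchange between X and Y'. By [hX] the side of X does not
   gain from it, so the side of Y' does not lose. *)
have closer Y' : Y' \in D -> i \notin Y' -> Y' :\: X \subset Y :\: X ->
    (#|X :\: Y'| + #|Y' :\: X| < #|X :\: Y| + #|Y :\: X|)%N ->
    exists J, [/\ J \subset Y' :\: X, (#|J| <= 1)%N, Y' :\: J :|: [set i] \in D &
      h Y' <= h (Y' :\: J :|: [set i])].
  move=> Y'D iY' sY' lt; have [|J [sJ cJ D1 D2 le]] := IHn Y' _ XD Y'D iX iY'.
    exact: leq_trans lt len.
  exists J; split=> //; have sI : [set i] \subset X :\: Y' by rewrite sub1set inE iX iY'.
  have := weight_exchange q sI sJ; have := hX J (subset_trans sJ sY') cJ D1.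
  rewrite /h; lra.
have mexh : mult_exchange D h by apply: mult_exchange_weight.
have [/existsP[i0 /and3P[i0X i0Y i0i]]|/existsPn only] :=
  boolP [exists i0, [&& i0 \in X, i0 \notin Y & i0 != i]].
  have [|J0 [s0 c0 J0D best]] := @best_removal Y (Y :\: X) [set i0] h.
    have [|J [sJ _ YJD _]] := mex X Y [set i0] XD YD; first by rewrite sub1set inE i0X i0Y.
    have sJY : J \subset Y by rewrite (subset_trans sJ) ?subsetDl.
    have [J1 [sJ1 c1 D1]] := reduce_to_one mex YD i0Y sJY YJD.
    by exists J1; split=> //; apply: subset_trans sJ.
  pose Y' := Y :\: J0 :|: [set i0]; rewrite -/Y' in J0D best.
  have iY' : i \notin Y' by rewrite !inE (negPf iY) andbF eq_sym (negPf i0i).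
  have sY' : Y' :\: X \subset Y :\: X.
    by apply/subsetP => z; rewrite !inE; case: (eqVneq z i0) => [->|_]; rewrite ?i0X; bcase.
  have [|J [sJ cJ BD le]] := closer Y' J0D iY' sY'.
    rewrite -addSn leq_add ?subset_leq_card //.
    apply: proper_card; apply/properP; split; last first.
      by exists i0; rewrite !inE ?eqxx ?orbT ?i0X ?i0Y.
    apply/subsetP => z; move: (subset_implyb z s0); rewrite !inE; bcase; by [].
  have eB : Y' :\: J :|: [set i] = Y :\: (J0 :|: J) :|: [set i0; i].
    apply/setP => z; move: (subset_implyb z sJ); rewrite !inE.
    by case: (eqVneq z i0) => [->|_]; rewrite ?i0X; bcase.
  rewrite eB in BD le.
  have sJY : J \subset Y :\: X by apply: subset_trans sY'.
  have s0Y : J0 \subset Y by rewrite (subset_trans s0) ?subsetDl.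
  have s1Y : J \subset Y by rewrite (subset_trans sJY) ?subsetDl.
  have dis : [disjoint J0 & J].
    rewrite -setI_eq0; apply/eqP/setP => z; move: (subset_implyb z sJ) (subset_implyb z s0Y).
    by rewrite !inE; case: (eqVneq z i0) => [->|_]; rewrite ?i0X ?(negPf i0Y); bcase.
  (* Either outcome has a sum below [h Y + h Y']: one set is below Y by [hY], and the other is Y' or
     at most Y' by the choice of J0. But the set reached from Y' is at least Y'. *)
  have [[D1 D2 sum]|[D1 D2 sum]] := exchange_two_two mexh YD BD i0Y iY i0i s0Y s1Y dis c0 cJ.
    by have := hY J sJY cJ D2; move: sum le; rewrite /h /Y' /=; lra.
  by have := hY J0 s0 c0 D1; have := best J sJY cJ D2; move: sum le; rewrite /h /Y' /=; lra.
have XYi : X :\: Y = [set i].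
  apply/setP => z; rewrite !inE; have := only z; case: (eqVneq z i) => [->|_].
    by rewrite iX iY.
  by rewrite andbT; bcase.
have [YX|/set0Pn[j jW]] := eqVneq (Y :\: X) set0.
  have e1 : X :\: [set i] :|: set0 = Y.
    by rewrite setU0 -XYi setDDr setDv set0U; apply/setIidPr; rewrite -setD_eq0 YX.
  have e2 : Y :\: set0 :|: [set i] = X.
    rewrite setD0 -XYi; apply/setP => z; move: (in_set0 z); rewrite -YX !inE; bcase; by [].
  by have := viol set0; rewrite sub0set cards0 e1 e2 addrC ltxx => /(_ isT isT YD XD).
have sub1W (z : T) : z \in Y :\: X -> [set z] \subset Y :\: X by rewrite sub1set.
(* Move j from Y to X. If [i] came back, [hX] and [hY] would contradict the inequality; so X + j is
   reached, and [hXj] bounds it by X. *)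
have YjD : Y :\: [set j] :|: set0 \in D /\ h Y <= h (Y :\: [set j] :|: set0).
  have [K sK [D1 D2 le]] := mex_to mexh YD XD (sub1W j jW).
  rewrite XYi in sK; have [||K0|Ki] := @subset_le1 _ K [set i]; rewrite ?cards1 //.
    have := hXj j jW; rewrite setUC; move: D1 D2 le; rewrite K0 setD0 => D1 D2 le /(_ D2).
    by split=> //; move: le; rewrite /h /=; lra.
  rewrite Ki in D1 D2 le.
  have := hX [set j] (sub1W j jW); rewrite cards1 => /(_ isT D2).
  by have := hY [set j] (sub1W j jW); rewrite cards1 => /(_ isT D1); move: le; rewrite /h /=; lra.
rewrite setU0 in YjD; have [Y1D le1] := YjD.
(* J0 must be nonempty for Y' to be strictly closer to X. If the empty set is optimal, [[set j]] is
   optimal too by [le1]. *)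
have [J0 [s0 c0 J0D J00 best]] : exists J0 : {set T}, [/\ J0 \subset Y :\: X, (#|J0| <= 1)%N,
    Y :\: J0 \in D, J0 != set0 & forall J : {set T}, J \subset Y :\: X -> (#|J| <= 1)%N ->
      Y :\: J \in D -> h (Y :\: J) <= h (Y :\: J0)].
  have [|J0 [s0 c0 J0D best]] := @best_removal Y (Y :\: X) set0 h.
    by exists [set j]; rewrite sub1W ?cards1 // setU0.
  have {}best (J : {set T}) : J \subset Y :\: X -> (#|J| <= 1)%N -> Y :\: J \in D ->
      h (Y :\: J) <= h (Y :\: J0) by move: (best J); rewrite !setU0.
  rewrite setU0 in J0D; have [e0|n0] := eqVneq J0 set0; last by exists J0; split.
  exists [set j]; split; rewrite ?sub1W ?cards1 //.
    by rewrite -card_gt0 cards1.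
  by move=> J sJ cJ JD; have := best J sJ cJ JD; rewrite e0 setD0 => /le_trans; apply.
have hJ0 : h Y <= h (Y :\: J0).
  by apply: (le_trans le1); apply: best; rewrite ?sub1W ?cards1.
pose Y' := Y :\: J0; rewrite -/Y' in J0D best hJ0.
have iY' : i \notin Y' by rewrite !inE (negPf iY) andbF.
have sY' : Y' :\: X \subset Y :\: X by apply/setSD/subsetDl.
have [|J [sJ cJ BD le]] := closer Y' J0D iY' sY'.
  have -> : X :\: Y' = X :\: Y.
    by apply/setP => z; move: (subset_implyb z s0); rewrite !inE; bcase.
  rewrite ltn_add2l; apply: proper_card; apply/properP; split=> //.
  have /set0Pn[z zJ] := J00; exists z; first exact: (subsetP s0).
  by rewrite !inE zJ /= andbF.
have eB : Y' :\: J :|: [set i] = Y :\: (J0 :|: J) :|: [set i] by rewrite setDDl.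
rewrite eB in BD le.
have sJY : J \subset Y :\: X by apply: subset_trans sY'.
have s0Y : J0 \subset Y by rewrite (subset_trans s0) ?subsetDl.
have s1Y : J \subset Y by rewrite (subset_trans sJY) ?subsetDl.
have dis : [disjoint J0 & J].
  rewrite -setI_eq0; apply/eqP/setP => z; move: (subset_implyb z sJ).
  by rewrite !inE; bcase.
have [[D1 D2 sum]|[D1 D2 sum]] := exchange_one_two mexh YD BD iY s0Y s1Y dis.
  by have := hY J sJY cJ D2; move: sum le; rewrite /h /Y' /=; lra.
by have := hY J0 s0 c0 D1; have := best J sJY cJ D2; move: sum le; rewrite /h /Y' /=; lra.
Qed.
End MinimalViolation.

(** * Translation between [option R] and a domain with real values *)

Section Encoding.
Variables (R : realFieldType) (T : finType) (f : {set T} -> option R).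
Implicit Types (X Y I J : {set T}).

(* Only meaningful on [dom f]: [value] is [0] where [f] is -oo. *)
Definition value X : R := odflt 0 (f X).

Lemma ele_emax (x : R) a b : ele (Some x) (emax a b) <-> ele (Some x) a \/ ele (Some x) b.
Proof.
case: a b => [a|] [b|] /=; try tauto.
by rewrite le_max; split=> [/orP//|[]->//]; rewrite orbT.
Qed.

Lemma ele_emax_seq (x : R) s :
  ele (Some x) (emax_seq s) <-> exists2 a, a \in s & ele (Some x) a.
Proof.
elim: s => [|a s IH]; first by split=> // -[].
rewrite [emax_seq _]/= ele_emax IH; split=> [[xa|[b bs xb]]|[b]].
- by exists a; rewrite ?mem_head.
- by exists b; rewrite // inE bs orbT.
- by rewrite inE => /orP[/eqP->|bs xb]; [left|right; exists b].
Qed.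

(** A finite left side forces both values on the right to be finite, so one [ele] carries two
    memberships and an inequality. *)
Lemma ele_value X Y X' Y' : X \in dom f -> Y \in dom f ->
  ele (eadd (f X) (f Y)) (eadd (f X') (f Y')) <->
  [/\ X' \in dom f, Y' \in dom f & value X + value Y <= value X' + value Y'].
Proof.
rewrite !inE /value; case: (f X) => // a _; case: (f Y) => // b _.
by case: (f X') => [a'|]; case: (f Y') => [b'|] /=; split=> // -[].
Qed.

Lemma eleN X Y c : ~~ ((X \in dom f) && (Y \in dom f)) -> ele (eadd (f X) (f Y)) c.
Proof. by rewrite !inE; case: (f X) => // a; case: (f Y). Qed.

Lemma multiple_exchangeE : multiple_exchange f <-> mult_exchange (dom f) value.
Proof.
split=> mex X Y I; first move=> XD YD.
  by move=> sI; have [J [sJ /(ele_value _ _ XD YD)[? ? ?]]] := mex X Y I sI; exists J.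
move=> sI; have [/andP[XD YD]|ndom] := boolP ((X \in dom f) && (Y \in dom f)).
  by have [J [sJ ? ? ?]] := mex X Y I XD YD sI; exists J; split=> //; apply/ele_value.
by exists set0; split; [apply: sub0set | apply: eleN].
Qed.

Lemma Mnat_concaveE : dom f != set0 -> Mnat_concave f <-> mnat (dom f) value.
Proof.
move=> f0; split=> [[_ ex] X Y i XD YD iX iY|m].
  have := ex X Y i; rewrite inE iX iY => /(_ isT).
  have fX : f X = Some (value X) by move: XD; rewrite inE /value; case: (f X).
  have fY : f Y = Some (value Y) by move: YD; rewrite inE /value; case: (f Y).
  (* The left side is exposed as [Some _] to split the maximum, then folded back into the form of
     [ele_value]. *)
  rewrite {1}fX {1}fY [eadd _ _]/= ele_emax ele_emax_seq.
  rewrite -[Some _]/(eadd (Some _) (Some _)) -fX -fY.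
  case=> [|[x /mapP[j]]].
    move=> /(ele_value _ _ XD YD)[D1 D2 le]; exists set0.
    by rewrite sub0set cards0 setU0 setD0 setUC; split.
  rewrite mem_enum => jW -> /(ele_value _ _ XD YD)[D1 D2 le]; exists [set j].
  have ij : i != j by apply: contraTneq jW => <-; rewrite inE iX.
  have -> : Y :\: [set j] :|: [set i] = (i |: Y) :\ j.
    by apply/setP => z; rewrite !inE; case: (eqVneq z i) => [->|_]; rewrite ?ij; bcase.
  by rewrite sub1set jW cards1 setUC; split.
split=> // X Y i /setDP[iX iY].
have [/andP[XD YD]|ndom] := boolP ((X \in dom f) && (Y \in dom f)); last exact: eleN.
have [J [sJ J1 D1 D2 le]] := m X Y i XD YD iX iY.
have fX : f X = Some (value X) by move: XD; rewrite inE /value; case: (f X).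
have fY : f Y = Some (value Y) by move: YD; rewrite inE /value; case: (f Y).
rewrite {1}fX {1}fY [eadd _ _]/= ele_emax ele_emax_seq.
rewrite -[Some _]/(eadd (Some _) (Some _)) -fX -fY.
have [J0|/set0Pn[j jJ]] := eqVneq J set0.
  by left; apply/ele_value => //; move: D1 D2 le; rewrite J0 setU0 setD0 setUC.
have jW := subsetP sJ j jJ.
have ij : i != j by apply: contraTneq jW => <-; rewrite inE iX.
(* The bound on the size of J turns the nonempty case into the term of j in the inner maximum. *)
have Jj : J = [set j] by apply/esym/eqP; rewrite eqEcard sub1set jJ cards1.
right; eexists; first by apply/mapP; exists j; rewrite ?mem_enum.
have e : Y :\: [set j] :|: [set i] = (i |: Y) :\ j.
  by apply/setP => z; rewrite !inE; case: (eqVneq z i) => [->|_]; rewrite ?ij; bcase.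
by apply/ele_value => //; move: D1 D2 le; rewrite Jj e setUC.
Qed.
End Encoding.

Theorem theorem5 (R : realFieldType) (T : finType) (f : {set T} -> option R) :
  dom f != set0 ->
  (Mnat_concave f <-> multiple_exchange f).
Proof.
move=> f0; rewrite multiple_exchangeE Mnat_concaveE //; split.
  by move=> m X Y I XD YD sI; apply: mnat_multiple_exchange.
exact: mult_exchange_mnat.
Qed.
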